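(* Let $n\ge 5$ and $a\ge 0$ be integers, let $0<\alpha<1$, and let $1\le\hat{\tau}\le\hat{\tau}_{\max}=2^a\hat{\tau}$, where $\hat{\tau}$ is a real number with $n\hat{\tau}$ an integer. Then, based on $2n$ exact samples from $\pi$ and $2n^2\times M$ steps of the $K$-chain, where $M$ is a random variable taking values in $\{\hat{\tau},2\hat{\tau},2^2\hat{\tau},\ldots,2^a\hat{\tau}\}$, one can define an interval $I$ as follows. There is an adaptive procedure, depending only on $n,\alpha,\hat{\tau},a$ (and not on $S,\pi,K,g$), such that for every finite set $S$, every probability distribution $\pi=(\pi_i)_{i\in S}$ on $S$, every transition matrix $K=(k_{ij})_{i,j\in S}$ on $S$ with $\pi_i k_{ij}=\pi_j k_{ji}$ for all $i,j\in S$, and every $g:S\to\mathbb{R}$ with $0\le g\le 1$, the following holds. Let $(X^{(r)}_j)_{j\ge 0}$, $1\le r\le 2n$, be independent Markov chains with transition matrix $K$, each with initial state $X^{(r)}_0$ distributed according to $\pi$. The procedure, applied to the values $g(X^{(r)}_j)$, outputs a random variable $M\in\{\hat{\tau},2\hat{\tau},\ldots,2^a\hat{\tau}\}$ and a random interval $I$ satisfying $$\mathbf{P}\left(\bar{g}\notin I\right)\le\alpha,$$ $$\mathrm{length}(I)\le k^a_\alpha\,\frac{\log n}{n}\quad\text{if } 1\le \frac{M}{\hat{\tau}}<2^a,$$ and $$\mathbf{P}\left(M>96\,\max(\tau_2,\hat{\tau})\right)\le 3n(n+1)\exp\left(-\log^2 n\right),$$ where $\bar{g}=\sum_{i\in S}\pi_i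 g(i)$, $k^a_\alpha=2\left(\sqrt{2(a+1)/\alpha}+\log(4(a+1)/\alpha)\right)$, and $\tau_2$ is the relaxation time of $K$.
   Context: $\log$ is the natural logarithm and $\log^2 n=(\log n)^2$. The matrix $K$ is not assumed irreducible. Adaptive procedure: a stopping rule together with an output rule. For each $k\in\{0,1,\ldots,a\}$, whether $M=2^k\hat{\tau}$ is determined by the values $g(X^{(r)}_j)$, $1\le r\le 2n$, $0\le j\le 2^k n\hat{\tau}$, and on the event $M=2^k\hat{\tau}$ the endpoints of $I$ are functions of these same values. Both the stopping rule and the output rule are fixed functions of these values, depending only on $n,\alpha,\hat{\tau},a$. Thus each of the $2n$ chains is run for $nM$ steps, and the total number of chain steps used is $2n^2M$. Relaxation time: let $1=\lambda_1\ge\lambda_2\ge\cdots\ge\lambda_s\ge -1$ ($s=|S|$) be the eigenvalues of $K$, with multiplicity; then $\tau_2:=(1-\lambda_2)^{-1}$, with $\tau_2=\infty$ if $\lambda_2=1$. Assertions involving $\tau_2$ are made when this definition makes sense, i.e. $|S|\ge 2$ and all eigenvalues of $K$ are real (the latter is automatic when $\pi_i>0$ for all $i$). *)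

(* Defs.v *)
From HB Require Import structures.
From mathcomp Require Export all_boot all_order all_algebra.
From mathcomp Require Export mxpoly.
From mathcomp Require Export all_classical all_reals all_analysis.

Set Implicit Arguments.
Unset Strict Implicit.
Unset Printing Implicit Defensive.

Export Order.TTheory GRing.Theory Num.Theory.
Export numFieldNormedType.Exports.

Global Open Scope classical_set_scope.
Global Open Scope ring_scope.

Definition is_distribution (R : realType) (S : finType) (pi : S -> R) : Prop :=
  (forall i, 0 <= pi i) /\ \sum_i pi i = 1.

Definition is_transition (R : realType) (S : finType) (K : S -> S -> R) : Prop :=
  forall i, is_distribution (K i).

Definition reversible (R : realType) (S : finType) (pi : S -> R)
    (K : S -> S -> R) : Prop :=
  forall i j, pi i * K i j = pi j * K j i.

Definition kernel_mx (R : realType) (S : finType) (K : S -> S -> R) :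
    'M[R]_#|S| :=
  \matrix_(i, j) K (enum_val i) (enum_val j).

(* [l] lists the eigenvalues of K with multiplicity in decreasing order.  Such
   a list exists exactly when all the eigenvalues of K are real. *)
Definition eigenvalue_list (R : realType) (S : finType) (K : S -> S -> R)
    (l : seq R) : Prop :=
  sorted >=%R l /\ char_poly (kernel_mx K) = \prod_(z <- l) ('X - z%:P).

(* tau_2; the second largest eigenvalue is [l`_1], as [seq] counts from 0.
   Meaningful only if [l] has at least two entries. *)
Definition relaxation_time (R : realType) (l : seq R) : \bar R :=
  if l`_1 == 1 then +oo%E else ((1 - l`_1)^-1)%:E.

Section Chains.
Context (R : realType) (d : measure_display) (Omega : measurableType d).
Variables (P : probability Omega R) (S : finType).

(* S carries the discrete sigma-algebra. *)
Definition random_process (X : nat -> Omega -> S) : Prop :=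
  forall j s, measurable (X j @^-1` [set s]).

(* The Markov property is
   P(X_0 = x_0, ..., X_{j+1} = x_{j+1}) =
     P(X_0 = x_0, ..., X_j = x_j) * K(x_j, x_{j+1}),
   i.e. the usual one without division by a possibly null probability. *)
Definition markov_chain (pi : S -> R) (K : S -> S -> R)
    (X : nat -> Omega -> S) : Prop :=
  [/\ random_process X,
      forall s, P (X 0%N @^-1` [set s]) = (pi s)%:E &
      forall (j : nat) (x : nat -> S),
        P [set w | forall i, (i <= j.+1)%N -> X i w = x i] =
        (P [set w | forall i, (i <= j)%N -> X i w = x i]
           * (K (x j) (x j.+1))%:E)%E].

Definition process_sigma (X : nat -> Omega -> S) : set (set Omega) :=
  <<s [set E | exists j s, E = X j @^-1` [set s]] >>.

Definition independent_processes (I : finType) (X : I -> nat -> Omega -> S) :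
    Prop :=
  forall (J : {set I}) (E : I -> set Omega),
    (forall r, r \in J -> process_sigma (X r) (E r)) ->
    P (\bigcap_(r in [set r | r \in J]) E r) = (\prod_(r in J) P (E r))%E.

End Chains.

(* An observation [y] records the values y r j = g(X^{(r)}_j) for the 2n
   chains; a procedure may look only at times j <= 2^k n tau. *)
Definition observations (R : realType) (n : nat) : Type := 'I_(2 * n) -> nat -> R.

Definition agree_upto (R : realType) (n : nat) (T : R)
    (y y' : observations R n) : Prop :=
  forall r (j : nat), j%:R <= T -> y r j = y' r j.

(* The stopping rule is given by the index k such that M = 2^k tau, and the
   output interval is I = [lower, upper]. *)
Record adaptive_procedure (R : realType) (n a : nat) (tau : R) :=
  AdaptiveProcedure {
    stop_index : observations R n -> 'I_a.+1;
    lower : observations R n -> R;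
    upper : observations R n -> R;
    lower_le_upper : forall y, lower y <= upper y;
    stop_index_adapted : forall (k : 'I_a.+1) (y y' : observations R n),
      agree_upto (2 ^+ k * n%:R * tau) y y' ->
      stop_index y = k -> stop_index y' = k;
    output_adapted : forall (k : 'I_a.+1) (y y' : observations R n),
      agree_upto (2 ^+ k * n%:R * tau) y y' ->
      stop_index y = k -> stop_index y' = k ->
      lower y = lower y' /\ upper y = upper y'
  }.

Definition run_length (R : realType) (n a : nat) (tau : R)
    (A : adaptive_procedure n a tau) (y : observations R n) : R :=
  2 ^+ stop_index A y * tau.

Definition output_interval (R : realType) (n a : nat) (tau : R)
    (A : adaptive_procedure n a tau) (y : observations R n) : interval R :=
  `[lower A y, upper A y].

Definition output_length (R : realType) (n a : nat) (tau : R)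
    (A : adaptive_procedure n a tau) (y : observations R n) : R :=
  upper A y - lower A y.

Definition k_const (R : realType) (a : nat) (alpha : R) : R :=
  2 * (Num.sqrt (2 * a.+1%:R / alpha) + ln (4 * a.+1%:R / alpha)).

(* Main.v *)
Require Import Defs.
From mathcomp Require Import ring lra.

(* At stage [k] each chain contributes the average of [g] over its first
   [2^k n tau] steps, so that one has 2n i.i.d. [0,1]-valued variables of mean
   gbar.  The procedure stops as soon as the first n of them lie within
   2 log n / sqrt n of each other; it then averages the other n, clipped to the
   range of the first n.  With [x = log (4 (a+1) / alpha) / n] the range misses
   more than [x] of the mass on either side with probability at most
   [2 (1 - x)^n <= alpha / (2 (a+1))], and otherwise clipping moves the mean by
   at most [x] while Chebyshev's inequality controls the clipped average; a
   union bound over the stages gives the coverage.  If no stage stops, the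
   answer is the interval [0,1].

   For the stopping time, a stage that fails to stop has an average deviating
   from gbar by more than log n / sqrt n, which is unlikely by a Chernoff bound
   once the run is long compared with n tau_2.  That bound comes from the
   spectral gap: the tilted operator [e^(theta h) K] has norm at most
   [1 + O(theta^2 / gap)] on a weighted L^2 space.  The variational form of the
   gap is obtained by deflating the eigenvalue 1: [K - 1 pi^T] has the same
   characteristic polynomial as [K], up to replacing one root 1 by 0. *)

Set Implicit Arguments.
Unset Strict Implicit.
Unset Printing Implicit Defensive.

(** * Eigenvalues of stochastic matrices and deflation of the eigenvalue 1 *)

Section Deflation.

(** The block matrix [B] is computed in two ways: through the Schur complement of its upper left
    entry, and by clearing [u] in the lower left. The extra factor [a] avoids division, so [a] may
    be a polynomial. *)
Lemma det_scalar_add_rank1 (A : comNzRingType) (n : nat) (a : A)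
    (u : 'cV[A]_n) (v : 'rV[A]_n) :
  \det (a%:M + u *m v) * a = (a + (v *m u) 0 0) * a ^+ n.
Proof.
pose B := block_mx (1%:M : 'M[A]_1) (- v) u a%:M.
have detB : \det B = \det (a%:M + u *m v).
  have -> : B = block_mx 1%:M 0 u 1%:M *m block_mx 1%:M (- v) 0 (a%:M + u *m v).
    by rewrite mulmx_block !mul1mx !mul0mx !mulmx1 !addr0 mulmxN addrCA addNr addr0.
  by rewrite det_mulmx det_lblock det_ublock !det1 !mul1r.
have := congr1 (fun M => \det M)
  (mulmx_block (1%:M : 'M[A]_1) (- v) u a%:M a%:M 0 (- u) 1%:M).
rewrite !mulmx0 !add0r !mulmx1 !mul1mx mulNmx mulmxN opprK mulmxN.
rewrite scalar_mxC subrr det_mulmx -/B detB det_lblock det1 mulr1.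
rewrite det_ublock !det_scalar expr1 => ->; congr (_ * _).
by rewrite det_mx11 !mxE eqxx mulr1n.
Qed.

(** Since [K u = u], the product [(X - K)((X - 1) + u v)] equals [(X - 1)(X - K + u v)]. On taking
    determinants the rank one factor contributes [X (X - 1)^(n-1)], because [v u = 1]. *)
Lemma char_poly_deflation (F : idomainType) (n : nat) (K : 'M[F]_n)
    (u : 'cV[F]_n) (v : 'rV[F]_n) :
  K *m u = u -> v *m u = 1%:M ->
  char_poly K * 'X = ('X - 1) * char_poly (K - u *m v).
Proof.
move=> Ku vu.
pose up := map_mx polyC u; pose vp := map_mx polyC v.
have vup : vp *m up = 1%:M by rewrite -map_mxM vu map_mx1.
have Kup : map_mx polyC K *m up = up by rewrite -map_mxM Ku.
have X1 : 'X - 1 != 0 :> {poly F} by rewrite -polyC1 polyXsubC_eq0.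
have rank1 := @det_scalar_add_rank1 {poly F} n ('X - 1) up vp.
rewrite vup mxE eqxx mulr1n subrK in rank1.
have prodE : char_poly_mx K *m (('X - 1)%:M + up *m vp)
    = ('X - 1) *: char_poly_mx (K - u *m v).
  have -> : char_poly_mx (K - u *m v) = char_poly_mx K + up *m vp.
    by rewrite /char_poly_mx map_mxB map_mxM opprB addrCA addrC.
  rewrite mulmxDr mul_mx_scalar mulmxA /char_poly_mx mulmxBl Kup mul_scalar_mx.
  by rewrite [RHS]scalerDr; congr (_ + _); rewrite mulmxBl -scalemxAl scalerBl scale1r.
have := congr1 (fun M => \det M * ('X - 1)) prodE.
rewrite det_mulmx detZ -mulrA rank1 => e.
apply: (mulIf (expf_neq0 n X1)).
by rewrite /char_poly -mulrA e; ring.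
Qed.

(** For a left eigenvector: a row-stochastic matrix does not increase the l1 norm of row vectors. *)
Lemma stochastic_eigenvalue_le1 (R : realType) (n : nat) (K : 'M[R]_n) (c : R) :
  (forall i j, 0 <= K i j) -> (forall i, \sum_j K i j = 1) ->
  eigenvalue K c -> c <= 1.
Proof.
move=> K0 K1 /eigenvalueP[v vK vn0].
have s0 : 0 < \sum_j `|v 0 j|.
  rewrite lt_def sumr_ge0 ?andbT//; apply: contra vn0 => /eqP s0.
  apply/eqP/rowP => j; rewrite mxE; apply/eqP; rewrite -normr_eq0; apply/eqP.
  exact: (psumr_eq0P (fun i _ => normr_ge0 (v 0 i)) s0).
rewrite -(ler_pM2r s0) mul1r mulr_sumr.
apply: (@le_trans _ _ (\sum_j \sum_i `|v 0 i| * K i j)).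
  apply: ler_sum => j _.
  apply: (@le_trans _ _ `|c * v 0 j|).
    by rewrite normrM ler_wpM2r// ler_norm.
  have -> : c * v 0 j = \sum_i v 0 i * K i j.
    by move/rowP/(_ j): vK; rewrite !mxE.
  apply: le_trans (ler_norm_sum _ _ _) _; apply: ler_sum => i _.
  by rewrite normrM (ger0_norm (K0 _ _)).
rewrite exchange_big/=; apply: ler_sum => i _.
by rewrite -mulr_sumr K1 mulr1.
Qed.

End Deflation.

(** * Quadratic forms of matrices self-adjoint for a weighted inner product *)

Section Rayleigh.
Variables (R : realType) (n : nat) (p : 'rV[R]_n) (B : 'M[R]_n).
Hypothesis p_ge0 : forall i, 0 <= p 0 i.

(** The weights may vanish, so this form is only positive semidefinite; the argument works with
    quadratic forms and does not pass through an orthonormal eigenbasis. *)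
Let dot (u v : 'cV[R]_n) : R := \sum_i p 0 i * u i 0 * v i 0.

Let dotC u v : dot u v = dot v u.
Proof. by apply: eq_bigr => i _; rewrite mulrAC. Qed.

Let dotDr u v w : dot u (v + w) = dot u v + dot u w.
Proof. by rewrite -big_split; apply: eq_bigr => i _; rewrite mxE mulrDr. Qed.

Let dotZr u v s : dot u (s *: v) = s * dot u v.
Proof.
by rewrite /dot mulr_sumr; apply: eq_bigr => i _; rewrite mxE mulrCA.
Qed.

Let dot_ge0 u : 0 <= dot u u.
Proof. by apply: sumr_ge0 => i _; rewrite -mulrA mulr_ge0// -expr2 sqr_ge0. Qed.

Let self_adjoint (A : 'M[R]_n) := forall i j, p 0 i * A i j = p 0 j * A j i.

Let dotA (A : 'M[R]_n) u v : self_adjoint A -> dot u (A *m v) = dot (A *m u) v.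
Proof.
move=> sA; rewrite /dot.
under eq_bigr => i _ do rewrite mxE mulr_sumr.
rewrite exchange_big/=; apply: eq_bigr => i _.
rewrite mxE mulr_sumr mulr_suml; apply: eq_bigr => j _.
by have := sA i j => /(congr1 (fun z => z * u j 0 * v i 0)) e; nra.
Qed.

Let self_adjoint_inv A : self_adjoint A -> A \in unitmx -> self_adjoint (invmx A).
Proof.
have sE (C : 'M[R]_n) : self_adjoint C <-> diag_mx p *m C = C^T *m diag_mx p.
  split=> [sC|eC i j].
    by apply/matrixP => i j; rewrite mul_diag_mx mul_mx_diag !mxE sC mulrC.
  move/matrixP/(_ i j): eC.
  by rewrite mul_diag_mx mul_mx_diag !mxE [RHS]mulrC.
move=> /sE sA uA; apply/sE.
rewrite -[LHS]mul1mx -(trmx1 R n) -(mulmxV uA) trmx_mul -!mulmxA (mulmxA A^T).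
by rewrite -sA -mulmxA mulmxV// mulmx1.
Qed.

(** By [2 u_i u_j <= u_i^2 + u_j^2] and the symmetry of [p_i |A_ij|], each row contributes at most
    its l1 norm. The constant is crude; only its finiteness matters. *)
Let dot_bound A u : self_adjoint A ->
  dot u (A *m u) <= (\sum_i \sum_j `|A i j|) * dot u u.
Proof.
move=> sA; rewrite /dot.
apply: (@le_trans _ _ (\sum_i \sum_j p 0 i * `|A i j| * ((u i 0) ^+ 2 + (u j 0) ^+ 2) / 2)).
  apply: ler_sum => i _; rewrite mxE mulr_sumr; apply: ler_sum => j _.
  have -> : p 0 i * u i 0 * (A i j * u j 0) = p 0 i * (A i j * (u i 0 * u j 0)) by ring.
  rewrite -!mulrA ler_wpM2l//; apply: le_trans (ler_norm _) _.
  rewrite normrM ler_wpM2l//.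
  have := sqr_ge0 (u i 0 - u j 0); have := sqr_ge0 (u i 0 + u j 0).
  by rewrite ler_norml => h1 h2; apply/andP; split; nra.
have -> : \sum_i \sum_j p 0 i * `|A i j| * ((u i 0) ^+ 2 + (u j 0) ^+ 2) / 2
    = \sum_i \sum_j p 0 i * `|A i j| * (u i 0) ^+ 2.
  have swap : \sum_i \sum_j p 0 i * `|A i j| * (u j 0) ^+ 2
      = \sum_i \sum_j p 0 i * `|A i j| * (u i 0) ^+ 2.
    rewrite exchange_big; apply: eq_bigr => i _; apply: eq_bigr => j _ /=.
    by rewrite -(ger0_norm (p_ge0 j)) -normrM -sA normrM (ger0_norm (p_ge0 i)).
  set r := (RHS); transitivity ((r + r) / 2); last by lra.
  rewrite /r -{2}swap -big_split mulr_suml; apply: eq_bigr => i _.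
  by rewrite -big_split mulr_suml; apply: eq_bigr => j _; rewrite mulrDr.
rewrite mulr_sumr; apply: ler_sum => i _.
have row_le : \sum_j `|A i j| <= \sum_k \sum_j `|A k j|.
  by rewrite [leRHS](bigD1 i)//= lerDl; apply: sumr_ge0 => k _; exact: sumr_ge0.
have := ler_wpM2l (mulr_ge0 (p_ge0 i) (sqr_ge0 (u i 0))) row_le.
by rewrite -mulr_suml -mulr_sumr; lra.
Qed.

(* If [c] is the infimum of the constants bounding the quadratic form of [B]
   and [c - B] is invertible, then [c - B], being positive semidefinite, is
   bounded below by a positive multiple of the identity, so that [c] can be
   lowered. *)
Lemma rayleigh_le (lam : R) :
  (forall i j, p 0 i * B i j = p 0 j * B j i) ->
  (forall v, dot v (B *m v) <= dot v v) ->
  (forall c, lam < c <= 1 -> ~~ eigenvalue B c) ->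
  forall v, dot v (B *m v) <= lam * dot v v.
Proof.
move=> sB B1 evB v.
have [lam1|lam1] := leP 1 lam.
  by apply: le_trans (B1 v) _; rewrite ler_peMl.
pose C := [set c | lam <= c /\ forall u, dot u (B *m u) <= c * dot u u].
have C1 : C 1 by split=> [|u]; [exact: ltW|rewrite mul1r].
have infC : has_inf C by split; [exists 1|exists lam => c []].
set c := inf C.
have lamc : lam <= c by apply: lb_le_inf => [|x []//]; exists 1.
have c1 : c <= 1 by apply: ge_inf C1; exact: (proj2 infC).
(* The infimum is attained: the bound passes to [c] after division by [dot u u], and when that
   vanishes [B1] gives the claim. *)
have cB u : dot u (B *m u) <= c * dot u u.
  rewrite leNgt; apply/negP => lt_c.
  have u0 : 0 < dot u u.
    rewrite lt_def dot_ge0 andbT; apply: contraTneq lt_c => u0.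
    by have := B1 u; rewrite u0 mulr0 -leNgt.
  rewrite -ltr_pdivlMr// in lt_c.
  have [x [_ /(_ u) Cx] xlt] := inf_lt (proj1 infC) lt_c.
  by rewrite ltr_pdivlMr// ltNge Cx in xlt.
have [->|clam] := eqVneq lam c; first exact: cB.
have ltlamc : lam < c by rewrite lt_neqAle clam.
pose A := c%:M - B.
have uA : A \in unitmx.
  rewrite unitmxE unitfE; apply/negP => /det0P[w wn0 wA].
  have := evB c; rewrite ltlamc c1 => /(_ isT) /negP; apply.
  apply/eigenvalueP; exists w => //.
  by apply/eqP; rewrite eq_sym -subr_eq0 -mul_mx_scalar -mulmxBr wA.
have sA : self_adjoint A.
  move=> i j; rewrite !mxE !mulrBr sB (eq_sym i j); congr (_ - _).
  by case: eqVneq => [->//|_]; rewrite !mulr0n !mulr0.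
have qE u : dot u (A *m u) = c * dot u u - dot u (B *m u).
  by rewrite mulmxBl mul_scalar_mx dotDr dotZr -scaleN1r dotZr mulN1r.
have q_ge0 u : 0 <= dot u (A *m u) by rewrite qE subr_ge0.
pose s := 1 + \sum_i \sum_j `|invmx A i j|.
have s_gt0 : 0 < s.
  by rewrite ltr_pwDl//; apply: sumr_ge0 => i _; apply: sumr_ge0.
have lowerA u : dot u u / s <= dot u (A *m u).
  pose y := invmx A *m u.
  have Ay : A *m y = u by rewrite mulKVmx.
  have yu : dot u y <= s * dot u u.
    apply: (le_trans (dot_bound u (self_adjoint_inv sA uA))).
    by rewrite ler_wpM2r// lerDr.
  (* Positivity at [u - y / s] gives [q(u) >= 2 |u|^2 / s - <u, y> / s^2], and [<u, y> <= s |u|^2]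
     by the bound on the inverse. *)
  have := q_ge0 (u + (- s^-1) *: y).
  rewrite mulmxDr -scalemxAr Ay dotDr dotZr.
  rewrite ![dot (u + _) _]dotC !dotDr !dotZr [dot (A *m u) u]dotC.
  have -> : dot (A *m u) y = dot u u by rewrite -(dotA _ _ sA) Ay.
  have si : 0 < s^-1 by rewrite invr_gt0.
  have : s^-1 * (s^-1 * dot u y) <= s^-1 * dot u u.
    by rewrite (ler_wpM2l (ltW si))// ler_pdivrMl.
  by rewrite [dot u u / s]mulrC; lra.
(* The maximum keeps the new constant above [lam], as membership in [C] requires; it is still
   smaller than [c]. *)
pose c' := Num.max lam (c - s^-1).
have : C c'.
  split=> [|u]; first by rewrite le_max lexx.
  apply: (@le_trans _ _ ((c - s^-1) * dot u u)); last first.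
    by rewrite ler_wpM2r// le_max lexx orbT.
  by have := lowerA u; rewrite qE; lra.
move=> /(ge_inf (proj2 infC)); rewrite -/c leNgt => /negP[].
by rewrite gt_max ltlamc ltrBlDr ltrDl invr_gt0.
Qed.

End Rayleigh.

(** * The spectral gap of a reversible kernel, in variational form *)

Lemma sum_enum_val (R : realType) (S : finType) (f : S -> R) :
  \sum_(i < #|S|) f (enum_val i) = \sum_i f i.
Proof. by rewrite -(big_enum_val f); apply: eq_bigl. Qed.

Section SpectralGap.
Variables (R : realType) (S : finType) (pi : S -> R) (K : S -> S -> R).
Hypotheses (pi_dist : is_distribution pi) (K_trans : is_transition K).
Hypothesis pi_rev : reversible pi K.

Lemma stationary j : \sum_i pi i * K i j = pi j.
Proof.
under eq_bigr => i _ do rewrite pi_rev.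
by rewrite -mulr_sumr (proj2 (K_trans j)) mulr1.
Qed.

Lemma sum_stationary (f : S -> R) :
  \sum_i pi i * \sum_j K i j * f j = \sum_j pi j * f j.
Proof.
under eq_bigr => i _ do rewrite mulr_sumr.
rewrite exchange_big; apply: eq_bigr => j _ /=.
by rewrite -stationary mulr_suml; apply: eq_bigr => i _; rewrite mulrA.
Qed.

Lemma reversible_form_sym (u v : S -> R) :
  \sum_i pi i * u i * \sum_j K i j * v j = \sum_i pi i * v i * \sum_j K i j * u j.
Proof.
under eq_bigr => i _ do rewrite mulr_sumr.
rewrite exchange_big; apply: eq_bigr => j _ /=.
rewrite mulr_sumr; apply: eq_bigr => i _.
transitivity (pi i * K i j * (u i * v j)); first by ring.
by rewrite pi_rev; ring.
Qed.

(** [2 v_i v_j <= v_i^2 + v_j^2] under the weights [pi_i K_ij], whose two marginals are both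
    [pi]. *)
Lemma reversible_contraction (v : S -> R) :
  \sum_i pi i * v i * \sum_j K i j * v j <= \sum_i pi i * v i ^+ 2.
Proof.
have [pi_ge0 pi1] := pi_dist.
have e : \sum_i pi i * v i ^+ 2
    = (\sum_i pi i * v i ^+ 2 * \sum_j K i j + \sum_i pi i * \sum_j K i j * v j ^+ 2) / 2.
  rewrite sum_stationary.
  under [X in (X + _) / 2]eq_bigr => i _ do rewrite (proj2 (K_trans i)) mulr1.
  by lra.
rewrite e -big_split mulr_suml; apply: ler_sum => i _ /=.
rewrite !mulr_sumr -big_split mulr_suml; apply: ler_sum => j _ /=.
have w0 := mulr_ge0 (pi_ge0 i) (proj1 (K_trans i) j).
have := mulr_ge0 w0 (sqr_ge0 (v i - v j)); nra.
Qed.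

Lemma eigenvalue_list_size l : eigenvalue_list K l -> size l = #|S|.
Proof.
move=> [_ /(congr1 (fun q : {poly R} => size q))].
by rewrite size_char_poly size_prod_XsubC => -[].
Qed.

Lemma kernel_row_sum i : \sum_j kernel_mx K i j = 1.
Proof.
under eq_bigr => j _ do rewrite mxE.
by rewrite (sum_enum_val (K (enum_val i))) (proj2 (K_trans _)).
Qed.

Lemma mem_eigenvalue_list_le1 l c : eigenvalue_list K l -> c \in l -> c <= 1.
Proof.
move=> [_ charK] cl; apply: (@stochastic_eigenvalue_le1 _ _ (kernel_mx K)).
- by move=> i j; rewrite mxE; exact: (proj1 (K_trans _)).
- exact: kernel_row_sum.
- by rewrite eigenvalue_root_char charK root_prod_XsubC.
Qed.

(** The matrix [Kc] agrees with [K] on centred functions, so the Rayleigh bound applies once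
    eigenvalues of [Kc] above [lam] are excluded. They are 0 and the entries of [l] other than its
    single 1; the 0 left by deflation is the reason for [0 <= lam]. *)
Lemma spectral_gap (l : seq R) (lam : R) :
  (2 <= #|S|)%N -> eigenvalue_list K l -> l`_1 != 1 -> l`_1 <= lam -> 0 <= lam ->
  forall (u : S -> R) (m : R), m = \sum_i pi i * u i ->
  \sum_i pi i * u i * \sum_j K i j * u j
    <= m ^+ 2 + lam * \sum_i pi i * (u i - m) ^+ 2.
Proof.
move=> S2 eigK l1 lelam lam0 u m mE; have [pi_ge0 pi1] := pi_dist.
have sizel := eigenvalue_list_size eigK.
pose p : 'rV[R]_#|S| := \row_i pi (enum_val i).
pose one : 'cV[R]_#|S| := const_mx 1.
pose Kc := kernel_mx K - one *m p.
have Kone : kernel_mx K *m one = one.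
  apply/colP => i; rewrite !mxE -[RHS](kernel_row_sum i).
  by apply: eq_bigr => j _; rewrite !mxE mulr1.
have pone : p *m one = 1%:M.
  apply/rowP => i; rewrite !mxE (ord1 i) eqxx mulr1n -pi1 -sum_enum_val.
  by apply: eq_bigr => j _; rewrite !mxE mulr1.
have defl := char_poly_deflation Kone pone; rewrite -/Kc in defl.
have [sorted_l charK] := eigK.
have l_1 : 1 \in l.
  rewrite -root_prod_XsubC -charK rootE.
  have /(congr1 (fun q => q.[1])) := defl.
  by rewrite !hornerE subrr mul0r => ->.
(* The second entry being below 1, the entry 1 that [l] must contain can only be its head. *)
have {sorted_l} [l' lE l'_le] : exists2 l', l = 1 :: l' & forall c, c \in l' -> c <= l`_1.
  have l1lt : l`_1 < 1.
    rewrite lt_neqAle l1; apply: mem_eigenvalue_list_le1 eigK _.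
    by rewrite mem_nth// sizel.
  case: l sorted_l sizel l_1 l1lt {l1 lelam eigK charK} => [|l0 [|z l']] //=; first by move=> _ e; rewrite -e in S2.
  move=> /andP[_ /(order_path_min (rev_trans le_trans))/allP z_max] _.
  rewrite !inE => /or3P[/eqP <-|/eqP <-|/z_max z1] z_lt1.
  + exists (z :: l') => // c; rewrite inE => /predU1P[->//|]; exact: z_max.
  + by rewrite ltxx in z_lt1.
  + by have := lt_le_trans z_lt1 z1; rewrite ltxx.
have charKc : char_poly Kc = 'X * \prod_(z <- l') ('X - z%:P).
  apply: (mulfI (_ : 'X - 1 != 0)); first by rewrite -polyC1 polyXsubC_eq0.
  by rewrite -defl charK lE big_cons polyC1; ring.
pose v : 'cV[R]_#|S| := \col_i (u (enum_val i) - m).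
have v_mean : \sum_i pi i * (u i - m) = 0.
  under eq_bigr => i _ do rewrite mulrBr.
  by rewrite sumrB -mulr_suml pi1 mul1r -mE subrr.
have formE (f : S -> R) (w := \col_i f (enum_val i) : 'cV[R]_#|S|) :
    \sum_i p 0 i * w i 0 * (Kc *m w) i 0
    = \sum_i pi i * f i * \sum_j K i j * f j - (\sum_i pi i * f i) ^+ 2.
  rewrite expr2 mulr_suml -sumrB -[RHS]sum_enum_val; apply: eq_bigr => i _.
  rewrite !mxE -mulrBr; congr (_ * _).
  rewrite -[X in X - _]sum_enum_val -[X in _ - X]sum_enum_val -sumrB; apply: eq_bigr => j _.
  by rewrite !mxE big_ord1 !mxE mul1r mulrBl.
have normE (f : S -> R) (w := \col_i f (enum_val i) : 'cV[R]_#|S|) :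
    \sum_i p 0 i * w i 0 * w i 0 = \sum_i pi i * f i ^+ 2.
  by rewrite -[RHS]sum_enum_val; apply: eq_bigr => i _; rewrite !mxE -mulrA.
have := @rayleigh_le R #|S| p Kc _ lam _ _ _ v.
rewrite (formE (fun s => u s - m)) (normE (fun s => u s - m)).
rewrite v_mean expr0n subr0 => h.
have -> : \sum_i pi i * u i * \sum_j K i j * u j
    = m ^+ 2 + \sum_i pi i * (u i - m) * \sum_j K i j * (u j - m).
  have Kv i : \sum_j K i j * (u j - m) = (\sum_j K i j * u j) - m.
    under eq_bigr => j _ do rewrite mulrBr.
    by rewrite sumrB -mulr_suml (proj2 (K_trans i)) mul1r.
  under [X in _ = _ + X]eq_bigr => i _ do rewrite Kv mulrBr [_ * m]mulrC.
  rewrite sumrB -mulr_sumr v_mean mulr0 subr0.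
  have e i : pi i * (u i - m) * \sum_j K i j * u j
      = pi i * u i * \sum_j K i j * u j - m * (pi i * \sum_j K i j * u j) by ring.
  under [X in _ = _ + X]eq_bigr => i _ do rewrite e.
  by rewrite sumrB -mulr_sumr sum_stationary -mE -expr2 addrC subrK.
rewrite lerD2l; apply: h.
- by move=> i; rewrite mxE.
- move=> i j; rewrite !mxE !big_ord1 !mxE !mul1r !mulrBr pi_rev; congr (_ - _); exact: mulrC.
- move=> w; have -> : w = \col_i (fun s => w (enum_rank s) 0) (enum_val i).
    by apply/colP => i; rewrite mxE enum_valK.
  set f := fun s => w (enum_rank s) 0.
  rewrite (formE f) (normE f) lerBlDr -[leLHS]addr0 lerD ?sqr_ge0//.
  exact: reversible_contraction.
- move=> c /andP[lamc c1]; apply/negP; rewrite eigenvalue_root_char charKc rootM.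
  rewrite rootX root_prod_XsubC => /orP[/eqP c0|/l'_le cl].
    by rewrite c0 ltNge lam0 in lamc.
  by have := le_lt_trans (le_trans cl lelam) lamc; rewrite ltxx.
Qed.

End SpectralGap.

(** * Weights of finite paths of a chain *)

Lemma sum_tuple0 (R : realType) (S : finType) (F : seq S -> R) :
  \sum_(s : 0.-tuple S) F s = F [::].
Proof.
rewrite (bigD1 [tuple])//= big1 ?addr0// => s.
by move/eqP; case; exact: tuple0.
Qed.

Lemma sum_tuple_cons (R : realType) (S : finType) (m : nat) (F : seq S -> R) :
  \sum_(s : m.+1.-tuple S) F s = \sum_x \sum_(s : m.-tuple S) F (x :: s).
Proof.
rewrite pair_big/=.
rewrite (reindex (fun q : S * m.-tuple S => [tuple of q.1 :: q.2]))//=.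
exists (fun s : m.+1.-tuple S => (thead s, [tuple of behead s])) => [[x s] _|s _] /=.
  by congr pair; apply: val_inj.
by rewrite -tuple_eta.
Qed.

Section PathWeight.
Variables (R : realType) (S : finType) (pi : S -> R) (K : S -> S -> R).

(** The probability that a chain now at [x] next follows [s]; the state [x] itself is not listed in
    [s]. *)
Fixpoint path_weight (x : S) (s : seq S) : R :=
  if s is y :: s' then K x y * path_weight y s' else 1.

Definition chain_weight (s : seq S) : R :=
  if s is x :: s' then pi x * path_weight x s' else 1.

Hypotheses (pi_dist : is_distribution pi) (K_trans : is_transition K).

Lemma path_weight_ge0 x s : 0 <= path_weight x s.
Proof.
by elim: s x => //= y s IH x; rewrite mulr_ge0//; exact: (proj1 (K_trans _)).
Qed.

Lemma chain_weight_ge0 s : 0 <= chain_weight s.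
Proof.
case: s => //= x s; rewrite mulr_ge0 ?path_weight_ge0//; exact: (proj1 pi_dist).
Qed.

Lemma sum_path_weight m x : \sum_(s : m.-tuple S) path_weight x s = 1.
Proof.
elim: m x => [x|m IH x]; first exact: (sum_tuple0 (path_weight x)).
rewrite (sum_tuple_cons _ (path_weight x)) -[RHS](proj2 (K_trans x)).
by apply: eq_bigr => y _ /=; rewrite -mulr_sumr IH mulr1.
Qed.

Lemma sum_chain_weight m : \sum_(s : m.-tuple S) chain_weight s = 1.
Proof.
case: m => [|m]; first exact: (sum_tuple0 chain_weight).
rewrite (sum_tuple_cons _ chain_weight) -[RHS](proj2 pi_dist).
by apply: eq_bigr => y _ /=; rewrite -mulr_sumr sum_path_weight mulr1.
Qed.

(** By stationarity each time contributes the mean of [g] under [pi]; the induction peels off the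
    first step and pushes [pi] through [K]. *)
Lemma sum_chain_weight_sum (g : S -> R) m : reversible pi K ->
  \sum_(s : m.-tuple S) chain_weight s * \sum_(y <- s) g y
  = m%:R * \sum_i pi i * g i.
Proof.
move=> pi_rev.
have pathE k : \sum_x pi x * \sum_(s : k.-tuple S) path_weight x s * \sum_(y <- s) g y
    = k%:R * \sum_i pi i * g i.
  elim: k => [|k IH].
    rewrite mul0r big1// => x _.
    by rewrite (sum_tuple0 (fun s => path_weight x s * \sum_(y <- s) g y)) big_nil !mulr0.
  have e x : \sum_(s : k.+1.-tuple S) path_weight x s * \sum_(y <- s) g y
      = \sum_y K x y * (g y + \sum_(s : k.-tuple S) path_weight y s * \sum_(z <- s) g z).
    rewrite (sum_tuple_cons _ (fun s => path_weight x s * \sum_(y <- s) g y)).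
    apply: eq_bigr => y _ /=.
    under eq_bigr => s _ do rewrite big_cons -mulrA mulrDr.
    by rewrite -mulr_sumr big_split/= -mulr_suml sum_path_weight mul1r.
  under eq_bigr => x _ do rewrite e.
  rewrite (sum_stationary K_trans pi_rev).
  under eq_bigr => x _ do rewrite mulrDr.
  by rewrite big_split/= IH -natr1; ring.
case: m => [|m].
  by rewrite (sum_tuple0 (fun s => chain_weight s * \sum_(y <- s) g y)) big_nil mulr0 mul0r.
rewrite (sum_tuple_cons _ (fun s => chain_weight s * \sum_(y <- s) g y)) /=.
transitivity (\sum_x pi x * (g x + \sum_(s : m.-tuple S) path_weight x s * \sum_(y <- s) g y)).
  apply: eq_bigr => x _ /=.
  under eq_bigr => s _ do rewrite big_cons -mulrA mulrDr.
  by rewrite -mulr_sumr big_split/= -mulr_suml sum_path_weight mul1r.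
under [LHS]eq_bigr => x _ do rewrite mulrDr.
by rewrite big_split/= pathE -natr1; ring.
Qed.

End PathWeight.

(** * A Chernoff bound from the spectral gap *)

Section Chernoff.
Variables (R : realType) (S : finType) (pi : S -> R) (K : S -> S -> R).
Hypotheses (pi_dist : is_distribution pi) (K_trans : is_transition K).
Hypothesis pi_rev : reversible pi K.
Variable gam : R.
Hypotheses (gam_gt0 : 0 < gam) (gam_le1 : gam <= 1).
Hypothesis gap : forall (u : S -> R) (m : R), m = \sum_i pi i * u i ->
  \sum_i pi i * u i * \sum_j K i j * u j
    <= m ^+ 2 + (1 - gam) * \sum_i pi i * (u i - m) ^+ 2.

Section Tilt.
Variables (h : S -> R) (theta : R).
Hypotheses (h_le1 : forall i, `|h i| <= 1) (h_mean : \sum_i pi i * h i = 0).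
Hypotheses (theta_ge0 : 0 <= theta) (theta_le : theta <= gam / 2).

Let form (u v : S -> R) := \sum_i pi i * u i * \sum_j K i j * v j.
Let nrm (u : S -> R) := \sum_i pi i * expR (- (theta * h i)) * u i ^+ 2.
Let rho : R := expR (4 * theta ^+ 2 / gam).

Let pi_ge0 i : 0 <= pi i. Proof. exact: (proj1 pi_dist). Qed.

Let nrm_ge0 u : 0 <= nrm u.
Proof.
by apply: sumr_ge0 => i _; rewrite mulr_ge0 ?sqr_ge0// mulr_ge0 ?expR_ge0.
Qed.

(** Write [u = m + v] and use [e^(-x) >= 1 - x] in [nrm]. The term [theta m^2 h] averages to 0, the
    cross term [2 theta h m v] is absorbed by [kap m^2 + (gam/2) h^2 v^2], and [theta h v^2] by
    another [(gam/2) v^2]. So [nrm u] is at least [1 - kap] times the bound that [gap] puts on the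
    form. *)
Lemma tilted_form_le u : form u u <= rho * nrm u.
Proof.
set m := \sum_i pi i * u i.
set V := \sum_i pi i * (u i - m) ^+ 2.
have V0 : 0 <= V by apply: sumr_ge0 => i _; rewrite mulr_ge0 ?sqr_ge0.
have v_mean : \sum_i pi i * (u i - m) = 0.
  under eq_bigr => i _ do rewrite mulrBr.
  by rewrite sumrB -mulr_suml (proj2 pi_dist) mul1r subrr.
pose kap := 2 * theta ^+ 2 / gam.
have kap_half : kap <= 1 / 2.
  have := ler_pM theta_ge0 theta_ge0 theta_le theta_le.
  have : gam * gam <= gam by rewrite (ler_piMr (ltW gam_gt0)).
  by rewrite ler_pdivrMr//; lra.
have kap0 : 0 <= kap by rewrite divr_ge0 ?(ltW gam_gt0)// mulr_ge0 ?sqr_ge0.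
(* [rho = e^(2 kap) >= 1 + 2 kap >= 1 / (1 - kap)], the last because [kap <= 1/2]. *)
have rho_kap : 1 <= rho * (1 - kap).
  apply: (@le_trans _ _ ((1 + 2 * kap) * (1 - kap))); first by nra.
  apply: ler_wpM2r; first by lra.
  have -> : rho = expR (2 * kap) by congr expR; rewrite /kap; ring.
  exact: expR_ge1Dx.
have lower : (1 - kap) * (m ^+ 2 + (1 - gam) * V) <= nrm u.
  apply: (@le_trans _ _ ((1 - kap) * m ^+ 2 + (1 - gam) * V)).
    rewrite mulrDr lerD2l mulrA ler_wpM2r//.
    have : 0 <= kap * (1 - gam) by rewrite mulr_ge0// subr_ge0.
    by lra.
  have -> : (1 - kap) * m ^+ 2 + (1 - gam) * V
      = \sum_i (pi i * ((1 - kap) * m ^+ 2 + (1 - gam) * (u i - m) ^+ 2)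
                + 2 * m * (pi i * (u i - m)) - theta * m ^+ 2 * (pi i * h i)).
    under eq_bigr => i _ do rewrite mulrDr.
    rewrite sumrB !big_split/= -!mulr_sumr h_mean v_mean !mulr0 subr0 addr0.
    rewrite -mulr_suml (proj2 pi_dist) mul1r; congr (_ + _).
    by rewrite mulr_sumr; apply: eq_bigr => i _; ring.
  apply: ler_sum => i _.
  apply: (@le_trans _ _ (pi i * ((1 - theta * h i) * u i ^+ 2))); last first.
    rewrite -mulrA ler_wpM2l// ler_wpM2r ?sqr_ge0//.
    exact: expR_ge1Dx.
  set v := u i - m; have -> : u i = m + v by rewrite /v; ring.
  have [hl hu] : - 1 <= h i /\ h i <= 1 by apply/andP; rewrite -ler_norml.
  have kapE : kap * m ^+ 2 - 2 * theta * h i * m * v + gam / 2 * (h i) ^+ 2 * v ^+ 2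
      = 2 / gam * (theta * m - gam / 2 * h i * v) ^+ 2.
    by rewrite /kap; field; rewrite gt_eqF.
  have sq0 : 0 <= 2 / gam * (theta * m - gam / 2 * h i * v) ^+ 2.
    by rewrite mulr_ge0 ?sqr_ge0// divr_ge0// ltW.
  have hv : (h i) ^+ 2 * v ^+ 2 <= v ^+ 2.
    rewrite ler_piMl ?sqr_ge0//.
    have : 0 <= (1 - h i) * (1 + h i) by rewrite mulr_ge0//; lra.
    by lra.
  have thv : theta * h i * v ^+ 2 <= gam / 2 * v ^+ 2.
    rewrite ler_wpM2r ?sqr_ge0//.
    by have := ler_wpM2l theta_ge0 hu; rewrite mulr1 => /le_trans; apply.
  have key : (1 - kap) * m ^+ 2 + (1 - gam) * v ^+ 2 + 2 * m * v - theta * m ^+ 2 * h i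
      <= (1 - theta * h i) * (m + v) ^+ 2.
    by have := ler_wpM2l (ltW gam_gt0) hv; lra.
  by have := ler_wpM2l (pi_ge0 i) key; lra.
have U0 : 0 <= m ^+ 2 + (1 - gam) * V.
  by rewrite addr_ge0 ?sqr_ge0// mulr_ge0// subr_ge0.
apply: le_trans (gap (erefl m)) _.
apply: (@le_trans _ _ (rho * ((1 - kap) * (m ^+ 2 + (1 - gam) * V)))).
  by rewrite mulrA ler_peMl.
by rewrite ler_wpM2l ?expR_ge0.
Qed.

(** Passing to [|u|] leaves [nrm] unchanged and does not decrease the form, [pi] and [K] being
    nonnegative. The lower bound serves in the polarization, where the form at a difference enters
    with a minus sign. *)
Lemma tilted_form_abs_le u : `|form u u| <= rho * nrm u.
Proof.
have -> : nrm u = nrm (fun i => `|u i|).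
  by apply: eq_bigr => i _; rewrite real_normK ?num_real.
apply: le_trans (tilted_form_le _); apply: le_trans (ler_norm_sum _ _ _) _.
apply: ler_sum => i _; rewrite !normrM (ger0_norm (pi_ge0 i)).
rewrite ler_wpM2l ?mulr_ge0//; apply: le_trans (ler_norm_sum _ _ _) _.
apply: ler_sum => j _; rewrite normrM ger0_norm//; exact: (proj1 (K_trans _)).
Qed.

(* The operator [u |-> e^(theta h) K u] is self-adjoint for the inner product
   behind [nrm]; polarization turns the bound on its quadratic form into a
   bound on its norm. *)
Lemma tilted_norm_le u :
  nrm (fun i => expR (theta * h i) * \sum_j K i j * u j) <= rho ^+ 2 * nrm u.
Proof.
set Tu := fun i => _; have rho0 : 0 < rho := expR_gt0 _.
(* The scaling balances the two vectors: in the extremal case [nrm Tu = rho^2 nrm u], [u] and [y]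
   have equal norms. *)
pose y i := rho^-1 * Tu i.
have pol : form (fun i => u i + y i) (fun i => u i + y i)
    - form (fun i => u i - y i) (fun i => u i - y i) = 4 / rho * nrm Tu.
  have formD c : form (fun i => u i + c * y i) (fun i => u i + c * y i)
      = form u u + 2 * c * form y u + c ^+ 2 * form y y.
    have Kc i : \sum_j K i j * (u j + c * y j)
        = \sum_j K i j * u j + c * \sum_j K i j * y j.
      by rewrite mulr_sumr -big_split; apply: eq_bigr => j _ /=; ring.
    have -> : 2 * c * form y u = c * form y u + c * form u y.
      by rewrite /form (reversible_form_sym pi_rev u y); ring.
    rewrite /form !mulr_sumr -!big_split; apply: eq_bigr => i _ /=.
    by rewrite Kc; ring.
  have -> : form (fun i => u i + y i) (fun i => u i + y i)
      = form (fun i => u i + 1 * y i) (fun i => u i + 1 * y i).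
    by congr form; apply/funext => i; rewrite mul1r.
  have -> : form (fun i => u i - y i) (fun i => u i - y i)
      = form (fun i => u i + - 1 * y i) (fun i => u i + - 1 * y i).
    by congr form; apply/funext => i; rewrite mulN1r.
  rewrite !formD.
  have -> : form y u = rho^-1 * nrm Tu.
    rewrite /form /nrm mulr_sumr; apply: eq_bigr => i _.
    have := expRxMexpNx_1 (theta * h i); rewrite /y /Tu.
    set e := expR _; set e' := expR _ => ee'.
    transitivity (pi i * rho^-1 * (e * e') * e * (\sum_j K i j * u j) ^+ 2); last by ring.
    by rewrite ee'; ring.
  by field; rewrite gt_eqF.
have par : nrm (fun i => u i + y i) + nrm (fun i => u i - y i)
    = 2 * nrm u + 2 * rho^-1 ^+ 2 * nrm Tu.
  rewrite /nrm !mulr_sumr -!big_split; apply: eq_bigr => i _ /=.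
  by rewrite /y; ring.
have := ler_norm (form (fun i => u i + y i) (fun i => u i + y i)).
have := ler_norm (- form (fun i => u i - y i) (fun i => u i - y i)).
rewrite normrN => h1 h2.
have h3 := le_trans h2 (tilted_form_abs_le _).
have h4 := le_trans h1 (tilted_form_abs_le _).
have h5 : 4 / rho * nrm Tu <= rho * (2 * nrm u + 2 * rho^-1 ^+ 2 * nrm Tu).
  by rewrite -par -pol mulrDr; lra.
have e1 : rho * (2 * nrm u + 2 * rho^-1 ^+ 2 * nrm Tu) = 2 * rho * nrm u + 2 / rho * nrm Tu.
  by field; rewrite gt_eqF.
have h6 : nrm Tu / rho <= rho * nrm u by move: h5; rewrite e1; lra.
by move: h6; rewrite ler_pdivrMr//; lra.
Qed.

(** [psi k] is the exponential moment over [k] further steps from a given state, that is, the [k]-th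
    iterate of the tilted operator on [e^(theta h)]. Each iteration multiplies the weighted norm by
    at most [rho], and Cauchy-Schwarz returns from the norm to the mean under [pi]. *)
Lemma path_mgf_le m :
  \sum_(s : m.+1.-tuple S) chain_weight pi K s * expR (theta * \sum_(y <- s) h y)
  <= expR theta * rho ^+ m.
Proof.
pose psi k x := expR (theta * h x) *
  \sum_(s : k.-tuple S) path_weight K x s * expR (theta * \sum_(y <- s) h y).
have psiS k x : psi k.+1 x = expR (theta * h x) * \sum_y K x y * psi k y.
  congr (_ * _).
  rewrite (sum_tuple_cons _ (fun s => path_weight K x s * expR (theta * \sum_(y <- s) h y))).
  apply: eq_bigr => y _ /=; rewrite /psi !mulr_sumr; apply: eq_bigr => s _.
  by rewrite big_cons mulrDr expRD; ring.
have psi0 x : psi 0%N x = expR (theta * h x).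
  rewrite /psi (sum_tuple0 (fun s => path_weight K x s * expR (theta * \sum_(y <- s) h y))).
  by rewrite big_nil mulr0 expR0 !mulr1.
have tilt_le i : expR (theta * h i) <= expR theta.
  rewrite ler_expR ler_piMr//; exact: le_trans (ler_norm _) (h_le1 i).
have sum_tilt : \sum_i pi i * expR (theta * h i) <= expR theta.
  rewrite -[leRHS]mul1r -(proj2 pi_dist) mulr_suml; apply: ler_sum => i _.
  by rewrite ler_wpM2l.
have psi_norm k : nrm (psi k) <= rho ^+ k ^+ 2 * expR theta.
  elim: k => [|k IH].
    rewrite expr0 expr1n mul1r; apply: le_trans sum_tilt.
    apply: ler_sum => i _; rewrite psi0 expr2 mulrA -(mulrA (pi i)).
    by rewrite [expR (- _) * _]mulrC expRxMexpNx_1 mulr1.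
  have -> : psi k.+1 = fun i => expR (theta * h i) * \sum_j K i j * psi k j.
    by apply/funext => x; rewrite psiS.
  apply: le_trans (tilted_norm_le _) _.
  rewrite (exprS rho k) exprMn -(mulrA (rho ^+ 2)).
  exact: ler_wpM2l (sqr_ge0 _) _ _ IH.
have -> : \sum_(s : m.+1.-tuple S) chain_weight pi K s * expR (theta * \sum_(y <- s) h y)
    = \sum_x pi x * psi m x.
  rewrite (sum_tuple_cons _ (fun s => chain_weight pi K s * expR (theta * \sum_(y <- s) h y))).
  apply: eq_bigr => x _ /=; rewrite /psi !mulr_sumr; apply: eq_bigr => s _.
  by rewrite big_cons mulrDr expRD; ring.
(* Cauchy-Schwarz against [e^(theta h)], in the form of a weighted AM-GM inequality: the weight [c]
   makes both halves at most [c e^theta]. *)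
set c := rho ^+ m; have c0 : 0 < c by rewrite exprn_gt0// expR_gt0.
apply: (@le_trans _ _ ((c * \sum_i pi i * expR (theta * h i) + c^-1 * nrm (psi m)) / 2)).
  rewrite !mulr_sumr -big_split mulr_suml; apply: ler_sum => i _ /=.
  have e1 := expRxMexpNx_1 (theta * h i).
  have e0 := expR_gt0 (theta * h i); have e0' := expR_gt0 (- (theta * h i)).
  set e := expR _ in e1 e0 *; set e' := expR (- _) in e1 e0' *.
  have cc : c * c^-1 = 1 by rewrite divff// gt_eqF.
  have ci : 0 < c^-1 by rewrite invr_gt0.
  have := mulr_ge0 (mulr_ge0 (ltW e0') (ltW ci)) (sqr_ge0 (psi m i - c * e)).
  have -> : e' / c * (psi m i - c * e) ^+ 2
      = e' * c^-1 * (psi m i) ^+ 2 - 2 * (e * e') * (c * c^-1) * psi m i + (e * e') * (c * c^-1) * (c * e).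
    by ring.
  rewrite e1 cc => le0.
  by have := mulr_ge0 (pi_ge0 i) le0; lra.
have le1 : c^-1 * nrm (psi m) <= c * expR theta.
  rewrite ler_pdivrMl// mulrA -expr2; exact: psi_norm.
have := ler_wpM2l (ltW c0) sum_tilt.
by lra.
Qed.

End Tilt.

(** Markov's inequality for the exponential moment. The value [theta = eps gam / 8] minimises
    [- theta eps + 4 theta^2 / gam], and [eps <= 4] keeps [theta <= gam / 2]. The factor [expR 1]
    absorbs [e^theta]. *)
Lemma path_tail_le (h : S -> R) (m : nat) (eps : R) :
  (forall i, `|h i| <= 1) -> \sum_i pi i * h i = 0 ->
  0 <= eps <= 4 ->
  \sum_(s : m.-tuple S | m%:R * eps < \sum_(y <- s) h y) chain_weight pi K s
  <= expR 1 * expR (- (m%:R * gam * eps ^+ 2 / 16)).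
Proof.
case: m => [|m] h1 hm /andP[eps0 eps4].
  rewrite !mul0r oppr0 expR0 mulr1 big1.
    exact: expR_ge0.
  by move=> s; rewrite (tuple0 s) big_nil ltxx.
pose theta := eps * gam / 8.
have theta0 : 0 <= theta by rewrite divr_ge0// mulr_ge0// ltW.
have theta_le : theta <= gam / 2.
  by rewrite /theta; have := ler_wpM2r (ltW gam_gt0) eps4; lra.
have := path_mgf_le h1 hm theta0 theta_le m.
set X := \sum_(s : _) _ => Xle.
apply: (@le_trans _ _ (expR (- (theta * (m.+1%:R * eps))) * X)).
  rewrite mulr_sumr big_mkcond; apply: ler_sum => s _.
  have w0 := chain_weight_ge0 pi_dist K_trans s.
  case: ifPn => [lt_s|_]; last by rewrite mulr_ge0 ?expR_ge0// mulr_ge0 ?expR_ge0.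
  rewrite mulrCA -expRD ler_peMr// -[leLHS]expR0 ler_expR.
  by have := ler_wpM2l theta0 (ltW lt_s); lra.
apply: le_trans (ler_wpM2l (expR_ge0 _) Xle) _.
rewrite -expRM_natl -!expRD ler_expR.
have e : 4 * theta ^+ 2 / gam = gam * eps ^+ 2 / 16.
  by rewrite /theta; field; rewrite gt_eqF.
have th1 : theta <= 1.
  by apply: le_trans theta_le _; move: gam_gt0 gam_le1; lra.
have q0 : 0 <= gam * eps ^+ 2 / 16 by rewrite divr_ge0// mulr_ge0 ?sqr_ge0// ltW.
by rewrite e -natr1 /theta; rewrite /theta in th1; lra.
Qed.

Lemma path_deviation_le (g : S -> R) (m : nat) (eps mu : R) :
  (0 < m)%N -> (forall i, 0 <= g i <= 1) -> mu = \sum_i pi i * g i ->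
  0 <= eps <= 4 ->
  \sum_(s : m.-tuple S | eps < `|(\sum_(y <- s) g y) / m%:R - mu|) chain_weight pi K s
  <= 2 * expR 1 * expR (- (m%:R * gam * eps ^+ 2 / 16)).
Proof.
move=> m0 g01 muE eps04.
have mR : 0 < m%:R :> R by rewrite ltr0n.
have mu01 : 0 <= mu <= 1.
  rewrite muE sumr_ge0/=; last first.
    by move=> i _; rewrite mulr_ge0 ?(proj1 pi_dist)//; case/andP: (g01 i).
  rewrite -(proj2 pi_dist); apply: ler_sum => i _.
  by rewrite ler_piMr ?(proj1 pi_dist)//; case/andP: (g01 i).
have hn1 i : `|g i - mu| <= 1 by rewrite ler_norml; have := g01 i; lra.
have hm : \sum_i pi i * (g i - mu) = 0.
  under eq_bigr => i _ do rewrite mulrBr.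
  by rewrite sumrB -mulr_suml (proj2 pi_dist) mul1r muE subrr.
have hn1' i : `|mu - g i| <= 1 by rewrite distrC.
have hm' : \sum_i pi i * (mu - g i) = 0.
  under eq_bigr => i _ do rewrite mulrBr.
  by rewrite sumrB -mulr_suml (proj2 pi_dist) mul1r muE subrr.
have up := path_tail_le m hn1 hm eps04; have dn := path_tail_le m hn1' hm' eps04.
rewrite -mulrA mulr_natl mulr2n; apply: le_trans (lerD up dn).
rewrite !(big_mkcond (fun s : m.-tuple S => _ < _)) -big_split; apply: ler_sum => s _ /=.
have w0 := chain_weight_ge0 pi_dist K_trans s.
have sumB : \sum_(y <- s) (g y - mu) = \sum_(y <- s) g y - m%:R * mu.
  by rewrite sumrB big_const_seq count_predT size_tuple iter_addr_0 mulr_natl.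
have sumB' : \sum_(y <- s) (mu - g y) = m%:R * mu - \sum_(y <- s) g y.
  by rewrite sumrB big_const_seq count_predT size_tuple iter_addr_0 mulr_natl.
rewrite sumB sumB'; case: ifPn => [|_]; last by apply: addr_ge0; case: ifP.
rewrite ltr_normr => /orP[lt_s|lt_s].
- rewrite ifT; last by rewrite mulrC -ltr_pdivlMr// mulrBl [m%:R * mu]mulrC mulfK ?gt_eqF.
  by rewrite lerDl; case: ifP.
- rewrite [X in _ + X]ifT; last first.
    rewrite mulrC -ltr_pdivlMr// mulrBl [m%:R * mu]mulrC mulfK ?gt_eqF//.
    by rewrite -opprB.
  by rewrite lerDr; case: ifP.
Qed.

End Chernoff.

(** * Clipping to the range of a sample *)

Section SampleStatistics.
Variables (R : realType) (n : nat).
Implicit Types a b : 'I_n -> R.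

(** For a nonempty sample with values in [0,1], the starting values 1 and 0 do not affect the
    minimum and the maximum. *)
Definition sample_min a : R := \big[Num.min/1]_i a i.
Definition sample_max a : R := \big[Num.max/0]_i a i.
Definition spread_le (D : R) a : bool := [forall i, forall j, a i - a j <= D].
Definition clip (lo hi x : R) : R := Num.max lo (Num.min hi x).
Definition clipped_mean a b : R :=
  (\sum_i clip (sample_min a) (sample_max a) (b i)) / n%:R.

Lemma clip_itv lo hi x : lo <= hi -> lo <= clip lo hi x <= hi.
Proof. by move=> lohi; rewrite /clip le_max lexx ge_max lohi ge_min lexx. Qed.

Lemma clip_above lo hi x : lo <= hi -> hi <= x -> clip lo hi x = hi.
Proof. by move=> lohi hix; rewrite /clip min_l// max_r. Qed.

Lemma sample_min_le a i : sample_min a <= a i.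
Proof. exact: bigmin_le. Qed.

Lemma sample_max_ge a i : a i <= sample_max a.
Proof. exact: le_bigmax. Qed.

Lemma sample_min_max_le a (i : 'I_n) : sample_min a <= sample_max a.
Proof. exact: le_trans (sample_min_le a i) (sample_max_ge a i). Qed.

Lemma spread_sample_le D a : 0 <= D -> (forall i, 0 <= a i <= 1) -> spread_le D a ->
  sample_max a - sample_min a <= D.
Proof.
move=> D0 a01 /forallP aD; rewrite lerBlDr -lerBlDl.
apply: le_bigmin => [|i _]; rewrite lerBlDl.
  apply: bigmax_le => [|i _]; first by rewrite addr_ge0.
  by case/andP: (a01 i) => _ /le_trans; apply; rewrite lerDr.
apply: bigmax_le => [|j _]; first by rewrite addr_ge0//; case/andP: (a01 i).
by rewrite -lerBlDr; move/forallP: (aD j).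
Qed.

End SampleStatistics.

(** * Independent samples from a finite distribution *)

Section FiniteSample.
Variables (R : realType) (W : finType) (p : W -> R).
Hypothesis p_dist : is_distribution p.

Let p_ge0 w : 0 <= p w. Proof. exact: (proj1 p_dist). Qed.

Definition sample_weight (n : nat) (v : {ffun 'I_n -> W}) : R := \prod_i p (v i).

Lemma sample_weight_ge0 n (v : {ffun 'I_n -> W}) : 0 <= sample_weight v.
Proof. exact: prodr_ge0. Qed.

Lemma sum_sample_weight n : \sum_(v : {ffun 'I_n -> W}) sample_weight v = 1.
Proof.
rewrite -(bigA_distr_bigA (fun _ => p)) big1// => i _; exact: (proj2 p_dist).
Qed.

(** Let [w] minimise [A] among the points with mass more than [x] strictly below them. The points
    below [w] fail this condition, so one sample satisfies it with probability at most [1 - x], and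
    [n] independent ones with probability at most [(1 - x)^n]. The strict inequality in the mass
    takes care of atoms of [A]. *)
Lemma sample_tail_le (n : nat) (A : W -> R) (x : R) :
  \sum_(v : {ffun 'I_n -> W} | [forall i, x < \sum_(w | A w < A (v i)) p w])
    sample_weight v <= expR (- (n%:R * x)).
Proof.
pose G w := x < \sum_(w' | A w' < A w) p w'.
have -> : \sum_(v : {ffun 'I_n -> W} | [forall i, G (v i)]) sample_weight v
    = (\sum_(w | G w) p w) ^+ n.
  rewrite -[in RHS](card_ord n) -prodr_const big_mkcond.
  under [RHS]eq_bigr => i _ do rewrite big_mkcond.
  rewrite (bigA_distr_bigA (fun _ w => if G w then p w else 0)).
  apply: eq_bigr => v _; case: ifPn => [/forallP Gv|/forallPn[i nGv]].
    by apply: eq_bigr => i _; rewrite Gv.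
  by rewrite (bigD1 i)//= (negbTE nGv) mul0r.
rewrite -mulrN expRM_natl lerXn2r ?nnegrE ?expR_ge0 ?sumr_ge0//.
have [w0 Gw0|noG] := pickP G; last first.
  by rewrite big_pred0 ?expR_ge0.
have [w Gw wmin] := @arg_minP _ _ W w0 G A Gw0.
apply: le_trans (expR_ge1Dx _); rewrite -[X in X - _](proj2 p_dist).
rewrite [X in X - _](bigID G)/= -addrA lerDl subr_ge0; apply: ltW; apply: lt_le_trans Gw _.
rewrite [leRHS](bigID (fun w' => A w' < A w))/=.
rewrite [X in X + _](eq_bigl (fun w' => A w' < A w)) ?lerDl ?sumr_ge0// => w'.
rewrite andb_idl// => ltw; apply: contraTN ltw => /wmin.
by rewrite leNgt.
Qed.

(** In the expanded square only the diagonal survives: by independence an off-diagonal term has the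
    mean of [f], which is 0, as a factor. *)
Lemma sample_variance (n : nat) (f : W -> R) : \sum_w p w * f w = 0 ->
  \sum_(v : {ffun 'I_n -> W}) sample_weight v * (\sum_i f (v i)) ^+ 2
  = n%:R * \sum_w p w * f w ^+ 2.
Proof.
move=> f0.
have cov (i j : 'I_n) : \sum_(v : {ffun 'I_n -> W}) sample_weight v * (f (v i) * f (v j))
    = if i == j then \sum_w p w * f w ^+ 2 else 0.
  pose F k w := p w * ((if k == i then f w else 1) * (if k == j then f w else 1)).
  transitivity (\sum_(v : {ffun 'I_n -> W}) \prod_k F k (v k)).
    apply: eq_bigr => v _; rewrite !big_split/=; congr (_ * (_ * _)).
    - by rewrite -big_mkcond big_pred1_eq.
    - by rewrite -big_mkcond big_pred1_eq.
  rewrite -bigA_distr_bigA; have [eij|ij] := eqVneq i j.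
    rewrite (bigD1 i)//= [X in _ * X]big1 ?mulr1 => [|k ki].
      by apply: eq_bigr => w _; rewrite /F -eij eqxx expr2.
    rewrite -[RHS](proj2 p_dist); apply: eq_bigr => w _.
    by rewrite /F -eij (negbTE ki) !mulr1.
  rewrite (bigD1 i)//= [X in X * _](_ : _ = 0) ?mul0r//.
  by rewrite -[RHS]f0; apply: eq_bigr => w _; rewrite /F eqxx (negbTE ij) mulr1.
under eq_bigr => v _.
  rewrite expr2 mulr_suml mulr_sumr.
  under eq_bigr => i _ do rewrite mulr_sumr mulr_sumr.
  over.
rewrite exchange_big/=.
under eq_bigr => i _.
  rewrite exchange_big/=.
  under eq_bigr => j _ do rewrite cov eq_sym.
  rewrite -big_mkcond big_pred1_eq.
  over.
by rewrite sumr_const card_ord mulr_natl.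
Qed.

Lemma sample_chebyshev (n : nat) (f : W -> R) (lo hi eps : R) :
  (0 < n)%N -> 0 < eps -> (forall w, lo <= f w <= hi) ->
  \sum_(v : {ffun 'I_n -> W} | eps < `|(\sum_i f (v i)) / n%:R - \sum_w p w * f w|)
    sample_weight v <= (hi - lo) ^+ 2 / (4 * n%:R * eps ^+ 2).
Proof.
move=> n0 eps0 fb; set m := \sum_w p w * f w.
have nR : 0 < n%:R :> R by rewrite ltr0n.
have c0 : \sum_w p w * (f w - m) = 0.
  under eq_bigr => w _ do rewrite mulrBr.
  by rewrite sumrB -mulr_suml (proj2 p_dist) mul1r subrr.
(* The variance is at most the second moment about the midpoint [(lo + hi) / 2], which
   [(f - lo)(hi - f) >= 0] bounds by a quarter of the squared range. *)
have var_le : \sum_w p w * (f w - m) ^+ 2 <= (hi - lo) ^+ 2 / 4.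
  pose d := m - (lo + hi) / 2.
  have e w : p w * (f w - m) ^+ 2
      = p w * (f w - (lo + hi) / 2) ^+ 2 - 2 * d * (p w * (f w - m)) - p w * d ^+ 2.
    by rewrite /d; ring.
  under eq_bigr => w _ do rewrite e.
  rewrite !sumrB -mulr_sumr c0 mulr0 subr0 -mulr_suml (proj2 p_dist) mul1r.
  apply: (@le_trans _ _ (\sum_w p w * (f w - (lo + hi) / 2) ^+ 2)).
    by rewrite gerBl sqr_ge0.
  rewrite -[leRHS]mul1r -[X in _ <= X * _](proj2 p_dist) mulr_suml; apply: ler_sum => w _.
  rewrite ler_wpM2l//; have [flo fhi] := andP (fb w).
  have : 0 <= (f w - lo) * (hi - f w) by rewrite mulr_ge0 ?subr_ge0.
  by lra.
have ne0 : 0 < (n%:R * eps) ^+ 2 by rewrite exprn_gt0// mulr_gt0.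
apply: (@le_trans _ _ ((n%:R * eps) ^- 2 *
    \sum_(v : {ffun 'I_n -> W}) sample_weight v * (\sum_i (f (v i) - m)) ^+ 2)).
  rewrite mulr_sumr big_mkcond; apply: ler_sum => v _.
  have w0 := sample_weight_ge0 v.
  case: ifPn => [lt_v|_]; last first.
    by rewrite mulr_ge0 ?invr_ge0 ?(ltW ne0)// mulr_ge0 ?sqr_ge0.
  rewrite mulrCA ler_peMr// mulrC ler_pdivlMr// mul1r -[leRHS]real_normK ?num_real//.
  rewrite lerXn2r ?nnegrE ?mulr_ge0 ?(ltW eps0) ?(ltW nR)//.
  rewrite sumrB sumr_const card_ord -[m *+ n]mulr_natl; apply: ltW.
  rewrite mulrC -ltr_pdivlMr//; apply: lt_le_trans lt_v _.
  rewrite -[X in _ <= _ / X](ger0_norm (ltW nR)) -normfV -normrM mulrBl.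
  by rewrite [n%:R * m]mulrC mulfK ?gt_eqF.
rewrite (sample_variance n c0).
have -> : (n%:R * eps) ^- 2 * (n%:R * \sum_w p w * (f w - m) ^+ 2)
    = (\sum_w p w * (f w - m) ^+ 2) / (n%:R * eps ^+ 2).
  by field; rewrite !gt_eqF.
have -> : (hi - lo) ^+ 2 / (4 * n%:R * eps ^+ 2)
    = (hi - lo) ^+ 2 / 4 / (n%:R * eps ^+ 2).
  by field; rewrite !gt_eqF.
by rewrite ler_wpM2r// invr_ge0 mulr_ge0 ?sqr_ge0// ltW.
Qed.

(** Clipping lowers values only above [hi] and raises them only below [lo], by at most 1, so each
    one-sided error is bounded by a single tail mass. *)
Lemma clip_bias (A : W -> R) (lo hi x : R) :
  (forall w, 0 <= A w <= 1) -> 0 <= lo -> lo <= hi -> hi <= 1 ->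
  \sum_(w | A w < lo) p w <= x -> \sum_(w | hi < A w) p w <= x ->
  `|\sum_w p w * clip lo hi (A w) - \sum_w p w * A w| <= x.
Proof.
move=> A01 lo0 lohi hi1 lox hix; rewrite -sumrB ler_norml; apply/andP; split.
- rewrite lerNl -sumrN; apply: le_trans hix; rewrite [leRHS]big_mkcond.
  apply: ler_sum => w _; rewrite -mulrBr -mulrN opprB.
  have [A0 A1] := andP (A01 w); have pw := p_ge0 w.
  case: ifPn => [lt|]; first by rewrite clip_above ?(ltW lt)// ler_piMr//; lra.
  rewrite -leNgt => le; rewrite mulr_ge0_le0// subr_le0 /clip.
  by rewrite min_r// le_max lexx orbT.
- apply: le_trans lox; rewrite [leRHS]big_mkcond.
  apply: ler_sum => w _; rewrite -mulrBr.
  have [A0 A1] := andP (A01 w); have pw := p_ge0 w.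
  case: ifPn => [lt|].
    rewrite ler_piMr//; have /andP[_] := clip_itv (A w) lohi; lra.
  rewrite -leNgt => le; rewrite mulr_ge0_le0// subr_le0 /clip.
  by rewrite ge_max le ge_min lexx orbT.
Qed.

(** Fix the first sample [u]. Either its range misses mass more than [x] on one side ([badl], or
    [badr], which is [badl] for [- A]), or clipping costs at most [x] and Chebyshev's inequality,
    with range at most [D], controls the second sample to within [eps]. *)
Lemma clipped_mean_coverage (n : nat) (A : W -> R) (D x eps H : R) :
  (0 < n)%N -> (forall w, 0 <= A w <= 1) -> 0 <= D -> 0 < eps -> x + eps <= H ->
  \sum_(u : {ffun 'I_n -> W}) \sum_(v : {ffun 'I_n -> W} |
      spread_le D (A \o u) &&
      (H < `|clipped_mean (A \o u) (A \o v) - \sum_w p w * A w|))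
    sample_weight u * sample_weight v
  <= 2 * expR (- (n%:R * x)) + D ^+ 2 / (4 * n%:R * eps ^+ 2).
Proof.
move=> n0 A01 D0 eps0 xH.
pose i0 := Ordinal n0.
pose lo (u : {ffun 'I_n -> W}) := sample_min (A \o u).
pose hi (u : {ffun 'I_n -> W}) := sample_max (A \o u).
pose badl (u : {ffun 'I_n -> W}) := [forall i, x < \sum_(w | A w < A (u i)) p w].
pose badr (u : {ffun 'I_n -> W}) := [forall i, x < \sum_(w | - A w < - A (u i)) p w].
set C := D ^+ 2 / _.
have C0 : 0 <= C by rewrite divr_ge0 ?sqr_ge0// mulr_ge0 ?sqr_ge0// mulr_ge0.
have inner (u : {ffun 'I_n -> W}) :
    \sum_(v : {ffun 'I_n -> W} | spread_le D (A \o u) &&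
      (H < `|clipped_mean (A \o u) (A \o v) - \sum_w p w * A w|)) sample_weight v
    <= (badl u)%:R + (badr u)%:R + C.
  have le1 (Q : pred {ffun 'I_n -> W}) : \sum_(v | Q v) sample_weight v <= 1.
    rewrite -(sum_sample_weight n) [leRHS](bigID Q)/= lerDl.
    by apply: sumr_ge0 => v _; exact: sample_weight_ge0.
  case: (boolP (badl u)) => [_|nbl].
    by apply: le_trans (le1 _) _; rewrite -addrA lerDl addr_ge0.
  case: (boolP (badr u)) => [_|nbr].
    by apply: le_trans (le1 _) _; rewrite add0r lerDl.
  rewrite !add0r; have [sp|nsp] /= := boolP (spread_le D (A \o u)); last first.
    by rewrite big_pred0.
  have lohi : lo u <= hi u := sample_min_max_le (A \o u) i0.
  have lo0 : 0 <= lo u by apply: le_bigmin => // i _; case/andP: (A01 (u i)).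
  have hi1 : hi u <= 1 by apply: bigmax_le => // i _; case/andP: (A01 (u i)).
  have bias : `|\sum_w p w * clip (lo u) (hi u) (A w) - \sum_w p w * A w| <= x.
    apply: clip_bias => //.
    - have [i] := forallPn nbl; rewrite -leNgt; apply: le_trans.
      rewrite big_mkcond [leRHS]big_mkcond; apply: ler_sum => w _.
      case: ifP => [lt|_]; last by case: ifP.
      by rewrite (lt_le_trans lt (sample_min_le (A \o u) i)).
    - have [i] := forallPn nbr; rewrite -leNgt; apply: le_trans.
      rewrite big_mkcond [leRHS]big_mkcond; apply: ler_sum => w _.
      case: ifP => [lt|_]; last by case: ifP.
      by rewrite ltrN2 (le_lt_trans (sample_max_ge (A \o u) i) lt).
  have ch := sample_chebyshev n0 eps0 (fun w => clip_itv (A w) lohi).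
  apply: (@le_trans _ _ ((hi u - lo u) ^+ 2 / (4 * n%:R * eps ^+ 2))); last first.
    rewrite ler_wpM2r//; first by rewrite invr_ge0 mulr_ge0 ?sqr_ge0// mulr_ge0.
    rewrite lerXn2r ?nnegrE ?subr_ge0//.
    by apply: spread_sample_le => // i; exact: A01.
  apply: le_trans ch; rewrite [leLHS]big_mkcond [leRHS]big_mkcond.
  apply: ler_sum => v _; case: ifPn => [lt|_]; last first.
    by case: ifP => // _; exact: sample_weight_ge0.
  rewrite ifT//.
  have := ler_distD (\sum_w p w * clip (lo u) (hi u) (A w))
    (clipped_mean (A \o u) (A \o v)) (\sum_w p w * A w).
  by rewrite /clipped_mean -/(lo u) -/(hi u) in lt *; lra.
apply: (@le_trans _ _ (\sum_(u : {ffun 'I_n -> W})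
    sample_weight u * ((badl u)%:R + (badr u)%:R + C))).
  apply: ler_sum => u _; rewrite -mulr_sumr ler_wpM2l ?sample_weight_ge0//.
have badE (Q : pred {ffun 'I_n -> W}) :
    \sum_(u : {ffun 'I_n -> W}) sample_weight u * (Q u)%:R = \sum_(u | Q u) sample_weight u.
  rewrite [RHS]big_mkcond; apply: eq_bigr => u _.
  by case: (Q u); rewrite ?mulr1 ?mulr0.
under eq_bigr => u _ do rewrite !mulrDr.
rewrite !big_split/= !badE -mulr_suml sum_sample_weight mul1r lerD2r.
rewrite mulr_natl mulr2n lerD//; [exact: sample_tail_le|].
exact: (sample_tail_le n (fun w => - A w)).
Qed.

End FiniteSample.

(** * Finite-valued random variables *)

Section FiniteValued.
Context (R : realType) (d : measure_display) (Omega : measurableType d).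
Variable P : probability Omega R.

Section Law.
Variables (T : finType) (Z : Omega -> T).
Hypothesis Z_meas : forall z, measurable (Z @^-1` [set z]).

Let event_bigsetU (Q : pred T) : [set w | Q (Z w)]
  = \big[setU/set0]_(i < #|T| | Q (enum_val i)) (Z @^-1` [set enum_val i]).
Proof.
apply/seteqP; split=> w /=; rewrite -bigcup_seq_cond/=.
  by move=> Qw; exists (enum_rank (Z w)); rewrite /= ?enum_rankK// mem_index_enum.
by case=> i /= /andP[_ Qi] ZwE; rewrite ZwE.
Qed.

Lemma finite_valued_measurable (Q : pred T) : measurable [set w | Q (Z w)].
Proof. by rewrite event_bigsetU; apply: bigsetU_measurable. Qed.

Lemma finite_valued_prob (q : T -> R) (Q : pred T) :
  (forall z, P (Z @^-1` [set z]) = (q z)%:E) ->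
  P [set w | Q (Z w)] = (\sum_(z | Q z) q z)%:E.
Proof.
move=> Pq; rewrite event_bigsetU measure_bigsetU_ord//; last first.
  by move=> i j _ _ [w [/= Zi Zj]]; apply: enum_val_inj; rewrite -Zi.
rewrite -sumEFin [RHS]big_mkcond [LHS]big_mkcond/=.
set f := fun z => if Q z then (q z)%:E else 0%E.
transitivity (\sum_(i < #|T|) f (enum_val i))%E.
  by apply: eq_bigr => i _; rewrite Pq.
by rewrite -(big_enum_val f); apply: eq_bigl.
Qed.

End Law.

Lemma union_bound (I : finType) (E : set Omega) (F : I -> set Omega) :
  measurable E -> (forall i, measurable (F i)) ->
  (forall w, E w -> exists i, F i w) -> (P E <= \sum_i P (F i))%E.
Proof.
move=> mE mF EF.
have [mU PU] : measurable (\big[setU/set0]_i F i) /\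
    (P (\big[setU/set0]_i F i) <= \sum_i P (F i))%E.
  elim/big_ind2: _ => [|A x B y [mA Ax] [mB By]|i _].
  - by rewrite measure0.
  - split; first exact: measurableU.
    by apply: le_trans (leeD Ax By); exact: measureU2.
  - by [].
apply: le_trans PU; apply: le_measure; rewrite ?inE//.
move=> w /EF[i Fi]; rewrite -bigcup_seq; exists i => //=.
by rewrite mem_index_enum.
Qed.

End FiniteValued.

(** * The law of the first states of a chain *)

Section PathLaw.
Context (R : realType) (d : measure_display) (Omega : measurableType d).
Variables (P : probability Omega R) (S : finType) (pi : S -> R) (K : S -> S -> R).

Definition path_of (X : nat -> Omega -> S) (T : nat) (w : Omega) : T.-tuple S :=
  [tuple X j w | j < T].

Lemma path_weight_rcons x s y :
  path_weight K x (rcons s y) = path_weight K x s * K (last x s) y.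
Proof. by elim: s x => [x|z s IH x] /=; rewrite ?mulr1 ?mul1r// IH mulrA. Qed.

Lemma cylinder_prob (X : nat -> Omega -> S) : markov_chain P pi K X ->
  forall (j : nat) (x : nat -> S),
  P [set w | forall i, (i <= j)%N -> X i w = x i]
  = (chain_weight pi K (mkseq x j.+1))%:E.
Proof.
move=> [_ X0 XS]; elim=> [|j IH] x.
  rewrite /= mulr1 -X0; congr (P _); apply/seteqP; split=> w /= Xw; first exact: Xw.
  by case.
rewrite XS IH -EFinM (mkseqS _ j.+1); congr (_%:E).
rewrite /mkseq /= path_weight_rcons mulrA; congr (_ * K _ _).
rewrite last_map (last_nth 0%N) size_iota -[(_ :: _)%N]/(iota 0 j.+1).
by rewrite nth_iota// add0n.
Qed.

Lemma path_of_preimage (X : nat -> Omega -> S) (T : nat) (s : T.-tuple S) :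
  path_of X T @^-1` [set s] = \bigcap_(j in [set: 'I_T]) (X j @^-1` [set tnth s j]).
Proof.
apply/seteqP; split=> w /=; first by move=> <- j _ /=; rewrite tnth_mktuple.
by move=> Xw; apply: eq_from_tnth => j; rewrite tnth_mktuple; exact: Xw.
Qed.

(** Independence of the chains is stated for events of their generated sigma-algebras, so path
    events have to be placed in these. *)
Lemma path_of_process_sigma (X : nat -> Omega -> S) (T : nat) (s : T.-tuple S) :
  process_sigma X (path_of X T @^-1` [set s]).
Proof.
rewrite path_of_preimage.
pose G := [set E | exists j s, E = X j @^-1` [set s]].
apply: (@fin_bigcap_measurable _ (g_sigma_algebraType G)) => // j _.
by apply: sub_sigma_algebra; exists j, (tnth s j).
Qed.

Lemma path_of_measurable (X : nat -> Omega -> S) (T : nat) (s : T.-tuple S) :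
  random_process X -> measurable (path_of X T @^-1` [set s]).
Proof.
move=> mX; rewrite path_of_preimage.
by apply: fin_bigcap_measurable => // j _; exact: mX.
Qed.

Lemma path_of_prob (X : nat -> Omega -> S) (T : nat) (s : T.-tuple S) :
  markov_chain P pi K X ->
  P (path_of X T @^-1` [set s]) = (chain_weight pi K s)%:E.
Proof.
move=> mcX; case: T s => [|T] s.
  rewrite (tuple0 s) /= -(probability_setT P); congr (P _).
  by apply/seteqP; split=> w //= _; rewrite [LHS]tuple0.
have x0 := thead s.
have -> : (s : seq S) = mkseq (nth x0 s) T.+1.
  by rewrite -{1}(mkseq_nth x0 s) size_tuple.
rewrite -(cylinder_prob mcX); congr (P _); apply/seteqP; split=> w /=.
  move=> <- i iT; have iT' : (i < T.+1)%N by [].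
  by rewrite -(tnth_nth x0 (path_of X T.+1 w) (Ordinal iT')) tnth_mktuple.
move=> Xw; apply: eq_from_tnth => j; rewrite tnth_mktuple (tnth_nth x0).
by apply: Xw; rewrite -ltnS.
Qed.

End PathLaw.

(** * The two halves of the chains and their joint law *)

Section Halves.
Variable n : nat.

Let two_n : (2 * n = n + n)%N. Proof. by rewrite mul2n addnn. Qed.

(** The left summand indexes the chains that decide when to stop, the right one those whose averages
    are clipped. *)
Definition half_of (r : 'I_(2 * n)) : 'I_n + 'I_n := fintype.split (cast_ord two_n r).
Definition of_half (s : 'I_n + 'I_n) : 'I_(2 * n) := cast_ord (esym two_n) (unsplit s).

Lemma half_ofK : cancel half_of of_half.
Proof. by move=> r; rewrite /half_of /of_half splitK cast_ordK. Qed.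

Lemma of_halfK : cancel of_half half_of.
Proof. by move=> s; rewrite /half_of /of_half cast_ordKV unsplitK. Qed.

Lemma prod_halves (R : realType) (F : 'I_(2 * n) -> R) :
  \prod_r F r = (\prod_i F (of_half (inl i))) * (\prod_i F (of_half (inr i))).
Proof.
rewrite (reindex of_half) ?big_sumType//.
by exists half_of => s _; [exact: of_halfK|exact: half_ofK].
Qed.

End Halves.

Section Joint.
Context (R : realType) (d : measure_display) (Omega : measurableType d).
Variables (P : probability Omega R) (S : finType) (pi : S -> R) (K : S -> S -> R).

Lemma joint_path_prob (I : finType) (X : I -> nat -> Omega -> S) (T : nat)
    (s : I -> T.-tuple S) :
  (forall r, markov_chain P pi K (X r)) -> independent_processes P X ->
  P [set w | forall r, path_of (X r) T w = s r] = (\prod_r chain_weight pi K (s r))%:E.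
Proof.
move=> mcX indX.
have -> : [set w | forall r, path_of (X r) T w = s r]
    = \bigcap_(r in [set r | r \in [set: I]%SET]) (path_of (X r) T @^-1` [set s r]).
  apply/seteqP; split=> w /= Pw r; first by move=> _; exact: Pw.
  by apply: Pw; rewrite /= inE.
rewrite indX; last by move=> r _; exact: path_of_process_sigma.
rewrite -prodEFin; apply: eq_big => [r|r _]; first by rewrite inE.
exact: path_of_prob.
Qed.

Variables (n : nat) (X : 'I_(2 * n) -> nat -> Omega -> S).
Hypothesis mcX : forall r, markov_chain P pi K (X r).

Definition half_paths (T : nat) (w : Omega) :
    {ffun 'I_n -> T.-tuple S} * {ffun 'I_n -> T.-tuple S} :=
  ([ffun i => path_of (X (of_half (inl i))) T w],
   [ffun i => path_of (X (of_half (inr i))) T w]).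

Let half_paths_preimage (T : nat) (z : {ffun 'I_n -> T.-tuple S} * {ffun 'I_n -> T.-tuple S}) :
  half_paths T @^-1` [set z]
  = [set w | forall r, path_of (X r) T w
                       = match half_of r with inl i => z.1 i | inr i => z.2 i end].
Proof.
apply/seteqP; split=> w /=.
  move=> <- r; rewrite -{1}(half_ofK r) /=.
  by case: (half_of r) => i; rewrite ffunE.
case: z => u v Xw; congr pair; apply/ffunP => i; rewrite ffunE Xw of_halfK//.
Qed.

Lemma half_paths_measurable (T : nat) z : measurable (half_paths T @^-1` [set z]).
Proof.
rewrite half_paths_preimage.
rewrite (_ : [set w | _] = \bigcap_(r in [set: 'I_(2 * n)]) (path_of (X r) T
    @^-1` [set match half_of r with inl i => z.1 i | inr i => z.2 i end])).
  apply: fin_bigcap_measurable => // r _; apply: path_of_measurable.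
  by case: (mcX r).
by apply/seteqP; split=> w /= Xw r => [_|]; exact: Xw.
Qed.

Lemma half_paths_prob (T : nat) z : independent_processes P X ->
  P (half_paths T @^-1` [set z])
  = (sample_weight (fun s : T.-tuple S => chain_weight pi K s) z.1
     * sample_weight (fun s : T.-tuple S => chain_weight pi K s) z.2)%:E.
Proof.
move=> indX; rewrite half_paths_preimage joint_path_prob// prod_halves.
by congr ((_ * _)%:E); apply: eq_bigr => i _; rewrite of_halfK.
Qed.

(** An event determined by the first [T] states of all chains is a finite union of atoms of
    [half_paths]. This gives the measurability of every event about the procedure. *)
Lemma observable_measurable (T : nat) (E : set Omega) :
  (forall w w', (forall r j, (j < T)%N -> X r j w = X r j w') -> E w -> E w') ->
  measurable E.
Proof.
move=> EX.
pose Q z := `[<exists2 w, E w & half_paths T w = z>].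
have -> : E = [set w | Q (half_paths T w)].
  apply/seteqP; split=> w /=; first by move=> Ew; apply/asboolP; exists w.
  move=> /asboolP[w' Ew' [/ffunP e1 /ffunP e2]]; apply: EX Ew' => r j jT.
  have : path_of (X r) T w' = path_of (X r) T w.
    rewrite -(half_ofK r); case: (half_of r) => i.
      by have := e1 i; rewrite !ffunE.
    by have := e2 i; rewrite !ffunE.
  by move=> /(congr1 (fun s => tnth s (Ordinal jT))); rewrite !tnth_mktuple.
exact: (finite_valued_measurable (@half_paths_measurable T)).
Qed.

End Joint.

(** * The stopping and output rules *)

Section Procedure.
Variables (R : realType) (n a : nat) (alpha tau : R) (N : nat).
Implicit Types y : observations R n.

(** The times are 0 to [T - 1], one fewer than the observation window up to [T] contains. *)
Definition block_mean y (T : nat) (r : 'I_(2 * n)) : R :=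
  (\sum_(j < T) y r j) / T%:R.
Definition pilot_means y T i := block_mean y T (of_half (inl i)).
Definition main_means y T i := block_mean y T (of_half (inr i)).
(** Twice the deviation in the Chernoff estimate: a larger spread forces one of the means to be more
    than [ln n / sqrt n] away from [gbar]. *)
Definition spread_bound : R := 2 * (ln n%:R / Num.sqrt n%:R).
Definition stops_at y (T : nat) : bool := spread_le spread_bound (pilot_means y T).
Definition estimate y (T : nat) : R := clipped_mean (pilot_means y T) (main_means y T).
(** Only stages below [a] are tested; [find] returns [a] when none of them stops. *)
Definition stop_stage y : nat := find (fun k => stops_at y (2 ^ k * N)) (iota 0 a).
Definition half_width : R :=
  (Num.sqrt (2 * a.+1%:R / alpha) + ln (4 * a.+1%:R / alpha)) * (ln n%:R / n%:R).
Definition ci_lower y : R :=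
  if (stop_stage y < a)%N then estimate y (2 ^ stop_stage y * N) - half_width else 0.
Definition ci_upper y : R :=
  if (stop_stage y < a)%N then estimate y (2 ^ stop_stage y * N) + half_width else 1.

Lemma stop_stage_le y : (stop_stage y <= a)%N.
Proof. by rewrite -[leqRHS](size_iota 0) find_size. Qed.

Lemma not_stops_before y k : (k < stop_stage y)%N -> ~~ stops_at y (2 ^ k * N).
Proof.
move=> k_lt; have k_a := leq_trans k_lt (stop_stage_le y).
by have := before_find 0%N k_lt; rewrite nth_iota// add0n => ->.
Qed.

Lemma stops_at_stop_stage y : (stop_stage y < a)%N -> stops_at y (2 ^ stop_stage y * N).
Proof.
move=> lt_a; have := lt_a; rewrite -{1}(size_iota 0 a) -has_find => /(nth_find 0%N).
by rewrite nth_iota.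
Qed.

Lemma eq_block_mean y y' (T : nat) : (forall r j, (j < T)%N -> y r j = y' r j) ->
  block_mean y T = block_mean y' T.
Proof.
move=> yy'; apply/funext => r; congr (_ / _).
by apply: eq_bigr => j _; exact: yy'.
Qed.

Lemma eq_stops_at y y' (T : nat) : (forall r j, (j < T)%N -> y r j = y' r j) ->
  stops_at y T = stops_at y' T.
Proof. by move=> /eq_block_mean e; rewrite /stops_at /pilot_means e. Qed.

Lemma eq_estimate y y' (T : nat) : (forall r j, (j < T)%N -> y r j = y' r j) ->
  estimate y T = estimate y' T.
Proof. by move=> /eq_block_mean e; rewrite /estimate /pilot_means /main_means e. Qed.

(** Every test up to the stopping stage of [y] reads only values shared with [y'], so neither can
    stop before the other. *)
Lemma stop_stage_adapted y y' :
  (forall r j, (j < 2 ^ stop_stage y * N)%N -> y r j = y' r j) ->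
  stop_stage y' = stop_stage y.
Proof.
move=> yy'; set k := stop_stage y in yy' *.
have e k' : (k' <= k)%N -> stops_at y (2 ^ k' * N) = stops_at y' (2 ^ k' * N).
  move=> k'k; apply: eq_stops_at => r j jlt; apply: yy'; apply: leq_trans jlt _.
  by rewrite leq_mul// leq_pexp2l.
apply/eqP; rewrite eqn_leq; apply/andP; split; rewrite leqNgt; apply/negP => lt.
  have := not_stops_before lt; rewrite -e// stops_at_stop_stage//.
  exact: leq_trans lt (stop_stage_le _).
have := not_stops_before lt; rewrite e ?(ltnW lt)// stops_at_stop_stage//.
exact: leq_trans lt (stop_stage_le _).
Qed.

Hypothesis N_def : n%:R * tau = N%:R.

Lemma agree_upto_blocks (k : nat) y y' :
  agree_upto (2 ^+ k * n%:R * tau) y y' ->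
  forall r j, (j < 2 ^ k * N)%N -> y r j = y' r j.
Proof.
move=> yy' r j jlt; apply: yy'.
by rewrite -mulrA N_def -natrX -natrM ler_nat ltnW.
Qed.

Lemma stop_stage_ord y (k : 'I_a.+1) : inord (stop_stage y) = k -> stop_stage y = k.
Proof. by move=> <-; rewrite inordK// ltnS stop_stage_le. Qed.

Lemma half_width_ge0 : (0 < n)%N -> 0 < alpha -> alpha < 1 -> 0 <= half_width.
Proof.
move=> n0 al0 al1; rewrite mulr_ge0//.
  rewrite addr_ge0 ?sqrtr_ge0// ln_ge0// ler_pdivlMr// mul1r.
  have : 1 <= a.+1%:R :> R by rewrite ler1n.
  lra.
by rewrite divr_ge0// ln_ge0// ler1n.
Qed.

Lemma ci_lower_le_upper : (0 < n)%N -> 0 < alpha -> alpha < 1 ->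
  forall y, ci_lower y <= ci_upper y.
Proof.
move=> n0 al0 al1 y; have := half_width_ge0 n0 al0 al1; rewrite /ci_lower /ci_upper.
by case: ifP => _; lra.
Qed.

Lemma stop_index_is_adapted (k : 'I_a.+1) y y' :
  agree_upto (2 ^+ k * n%:R * tau) y y' ->
  inord (stop_stage y) = k -> inord (stop_stage y') = k.
Proof.
move=> /agree_upto_blocks yy' /stop_stage_ord sk.
by rewrite (@stop_stage_adapted y y') sk ?inord_val.
Qed.

Lemma output_is_adapted (k : 'I_a.+1) y y' :
  agree_upto (2 ^+ k * n%:R * tau) y y' ->
  inord (stop_stage y) = k -> inord (stop_stage y') = k ->
  ci_lower y = ci_lower y' /\ ci_upper y = ci_upper y'.
Proof.
move=> /agree_upto_blocks yy' /stop_stage_ord sk /stop_stage_ord sk'.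
by rewrite /ci_lower /ci_upper sk sk' (eq_estimate yy').
Qed.

Definition clipping_procedure (n0 : (0 < n)%N) (al0 : 0 < alpha) (al1 : alpha < 1) :
    adaptive_procedure n a tau :=
  AdaptiveProcedure (ci_lower_le_upper n0 al0 al1) stop_index_is_adapted
    output_is_adapted.

End Procedure.

(** * Probability estimates for a single stage *)

Lemma ln_ge1 (R : realType) (n : nat) : (5 <= n)%N -> 1 <= ln n%:R :> R.
Proof.
move=> n5; have nR : 5 <= n%:R :> R by rewrite ler_nat.
(* From [e^(-1/2) >= 1/2]; squaring gives [e <= 4], which is below [n]. *)
have e2 : expR (1 / 2) <= 2 :> R.
  have := expR_ge1Dx (- (1 / 2) : R).
  have := expRxMexpNx_1 (1 / 2 : R); have := expR_gt0 (1 / 2 : R).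
  set e := expR (1 / 2); set e' := expR _ => e0 ee' he'.
  have := ler_wpM2l (ltW e0) he'; rewrite ee'; lra.
rewrite -ler_expR lnK ?posrE; last by lra.
apply: le_trans nR; have -> : 1 = 1 / 2 + 1 / 2 :> R by lra.
by rewrite expRD; have := ler_pM (expR_ge0 _) (expR_ge0 _) e2 e2; lra.
Qed.

(** Makes [ln n / sqrt n] an admissible [eps] in the Chernoff bound; it comes from
    [ln n = 2 ln (sqrt n) <= 2 (sqrt n - 1)]. *)
Lemma ln_le_4sqrt (R : realType) (n : nat) : (0 < n)%N ->
  ln n%:R <= 4 * Num.sqrt n%:R :> R.
Proof.
move=> n0; have nR : 0 < n%:R :> R by rewrite ltr0n.
have s0 : 0 < Num.sqrt n%:R :> R by rewrite sqrtr_gt0.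
rewrite -{1}(sqr_sqrtr (ltW nR)) lnXn// mulr2n.
have := @le_ln1Dx R (Num.sqrt n%:R - 1); rewrite (addrC 1) subrK => h.
by have := h ltac:(lra); lra.
Qed.

Section Main.
Variables (R : realType) (n : nat) (S : finType) (pi : S -> R) (K : S -> S -> R).
Variable (g : S -> R).
Context (d : measure_display) (Omega : measurableType d).
Variables (P : probability Omega R) (X : 'I_(2 * n) -> nat -> Omega -> S).
Hypotheses (n5 : (5 <= n)%N) (pi_dist : is_distribution pi).
Hypotheses (K_trans : is_transition K) (pi_rev : reversible pi K).
Hypothesis g01 : forall i, 0 <= g i <= 1.
Hypothesis mcX : forall r, markov_chain P pi K (X r).

Let obs (w : Omega) : observations R n := fun r j => g (X r j w).
Let gbar := \sum_i pi i * g i.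
Let path_mean (T : nat) (s : T.-tuple S) : R := (\sum_(y <- s) g y) / T%:R.
Let weight (T : nat) (s : T.-tuple S) : R := chain_weight pi K s.

Let n_gt0 : (0 < n)%N. Proof. exact: leq_trans n5. Qed.
Let nR : 0 < n%:R :> R. Proof. by rewrite ltr0n. Qed.

Lemma block_mean_path T r w : block_mean (obs w) T r = path_mean (path_of (X r) T w).
Proof.
congr (_ / _); rewrite big_tuple; apply: eq_bigr => j _.
by rewrite tnth_mktuple.
Qed.

Lemma path_mean_itv T (s : T.-tuple S) : (0 < T)%N -> 0 <= path_mean s <= 1.
Proof.
move=> T0; have TR : 0 < T%:R :> R by rewrite ltr0n.
rewrite /path_mean big_tuple divr_ge0 ?sumr_ge0//=; last first.
  by move=> j _; case/andP: (g01 (tnth s j)).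
rewrite ler_pdivrMr// mul1r; apply: (@le_trans _ _ (\sum_(j < T) 1)); last first.
  by rewrite sumr_const card_ord.
by apply: ler_sum => j _; case/andP: (g01 (tnth s j)).
Qed.

Lemma weight_dist T : is_distribution (@weight T).
Proof.
by split=> [s|]; [exact: chain_weight_ge0|exact: sum_chain_weight].
Qed.

Lemma path_mean_expectation T : (0 < T)%N -> \sum_s weight s * @path_mean T s = gbar.
Proof.
move=> T0; under eq_bigr => s _ do rewrite mulrA.
rewrite -mulr_suml (sum_chain_weight_sum K_trans)// mulrAC mulfV ?mul1r//.
by rewrite pnatr_eq0 -lt0n.
Qed.

(** The tail level [x = ln z / n] contributes [2 / z], and the Chebyshev level [eps = q ln n / n]
    contributes [1 / q^2]. Each is half of [alpha / (a + 1)], which explains the two terms of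
    [half_width]. *)
Lemma stage_coverage (a T : nat) (alpha : R) :
  independent_processes P X -> 0 < alpha -> alpha < 1 -> (0 < T)%N ->
  (P [set w | stops_at (obs w) T
              && (half_width n a alpha < `|estimate (obs w) T - gbar|)%R]
    <= (alpha / a.+1%:R)%:E)%E.
Proof.
move=> indX al0 al1 T0.
pose Q (z : {ffun 'I_n -> T.-tuple S} * {ffun 'I_n -> T.-tuple S}) :=
  spread_le (spread_bound R n) (@path_mean T \o z.1)
  && (half_width n a alpha < `|clipped_mean (@path_mean T \o z.1) (@path_mean T \o z.2) - gbar|).
have -> : [set w | stops_at (obs w) T
      && (half_width n a alpha < `|estimate (obs w) T - gbar|)]
    = [set w | Q (half_paths X T w)].
  apply/funext => w /=; rewrite /Q /stops_at /estimate.
  have -> : pilot_means (obs w) T = @path_mean T \o (half_paths X T w).1.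
    by apply/funext => i; rewrite /= ffunE -block_mean_path.
  have -> : main_means (obs w) T = @path_mean T \o (half_paths X T w).2.
    by apply/funext => i; rewrite /= ffunE -block_mean_path.
  by [].
rewrite (finite_valued_prob (half_paths_measurable mcX (T := T)) Q
  (fun z => half_paths_prob mcX z indX)) lee_fin.
rewrite -(pair_big_dep xpredT (fun u v => Q (u, v))
  (fun u v => sample_weight (@weight T) u * sample_weight (@weight T) v))/=.
set L : R := ln n%:R; have L1 : 1 <= L by exact: ln_ge1.
set s : R := Num.sqrt n%:R.
have s0 : 0 < s by rewrite sqrtr_gt0.
have s2 : s ^+ 2 = n%:R by rewrite sqr_sqrtr// ltW.
have aR : 0 < a.+1%:R :> R by rewrite ltr0n.
have a1 : 1 <= a.+1%:R :> R by rewrite ler1n.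
set z := 4 * a.+1%:R / alpha; have z1 : 1 <= z by rewrite ler_pdivlMr//; lra.
set q := Num.sqrt (2 * a.+1%:R / alpha).
have q_arg : 0 < 2 * a.+1%:R / alpha by rewrite divr_gt0// mulr_gt0.
have q0 : 0 < q by rewrite sqrtr_gt0.
have q2 : q ^+ 2 = 2 * a.+1%:R / alpha by rewrite sqr_sqrtr// ltW.
have D0 : 0 <= spread_bound R n.
  by rewrite mulr_ge0// divr_ge0 ?sqrtr_ge0// (le_trans ler01).
have eps0 : 0 < q * (L / n%:R) by rewrite mulr_gt0// divr_gt0// (lt_le_trans ltr01).
(* Here [ln n >= 1] allows [ln z / n] to be replaced by [ln z] times [ln n / n]. *)
have xH : ln z / n%:R + q * (L / n%:R) <= half_width n a alpha.
  rewrite /half_width -/z -/q -/L mulrDl addrC lerD2l.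
  rewrite mulrA ler_wpM2r ?invr_ge0 ?(ltW nR)//.
  by rewrite ler_peMr// ln_ge0.
have := clipped_mean_coverage (weight_dist T) n_gt0 (fun s => path_mean_itv s T0) D0 eps0 xH.
rewrite path_mean_expectation// => /le_trans; apply.
have -> : n%:R * (ln z / n%:R) = ln z by rewrite mulrCA mulfV ?mulr1// gt_eqF.
rewrite expRN lnK ?posrE ?(lt_le_trans ltr01 z1)//.
have -> : spread_bound R n ^+ 2 / (4 * n%:R * (q * (L / n%:R)) ^+ 2) = alpha / a.+1%:R / 2.
  have -> : spread_bound R n ^+ 2 = 4 * L ^+ 2 / n%:R.
    rewrite /spread_bound -/L -/s -s2; field.
    by rewrite gt_eqF.
  rewrite exprMn q2; field.
  by rewrite !gt_eqF// (lt_le_trans ltr01).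
have -> : 2 * z^-1 = alpha / a.+1%:R / 2.
  by rewrite /z; field; rewrite !gt_eqF.
by rewrite -splitr.
Qed.

(** At [eps = ln n / sqrt n] the constant 48, three times 16, makes the Chernoff exponent at least
    [3 (ln n)^2]; since [ln n >= 1], the part beyond [(ln n)^2] absorbs the factor [e]. *)
Lemma block_deviation (gam : R) (T : nat) (r : 'I_(2 * n)) :
  0 < gam -> gam <= 1 ->
  (forall (u : S -> R) (m : R), m = \sum_i pi i * u i ->
    \sum_i pi i * u i * \sum_j K i j * u j
      <= m ^+ 2 + (1 - gam) * \sum_i pi i * (u i - m) ^+ 2) ->
  (0 < T)%N -> 48 * n%:R <= T%:R * gam ->
  (P [set w | (ln n%:R / Num.sqrt n%:R < `|block_mean (obs w) T r - gbar|)%R]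
    <= (2 * expR (- ln n%:R ^+ 2))%:E)%E.
Proof.
move=> gam0 gam1 gap T0 Tgam.
set L : R := ln n%:R; have L1 : 1 <= L by exact: ln_ge1.
set s : R := Num.sqrt n%:R.
have s0 : 0 < s by rewrite sqrtr_gt0.
have s2 : s ^+ 2 = n%:R by rewrite sqr_sqrtr// ltW.
pose Q (p : T.-tuple S) := L / s < `|path_mean p - gbar|.
have -> : [set w | L / s < `|block_mean (obs w) T r - gbar|]
    = [set w | Q (path_of (X r) T w)].
  by apply/funext => w /=; rewrite /Q -block_mean_path.
have [mX _ _] := mcX r.
rewrite (finite_valued_prob (fun p => path_of_measurable p mX) Q
  (fun p => path_of_prob p (mcX r))) lee_fin.
have eps04 : 0 <= L / s <= 4.
  rewrite divr_ge0 ?(ltW s0) ?(le_trans ler01)//= ler_pdivrMr//.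
  exact: ln_le_4sqrt.
have := path_deviation_le pi_dist K_trans pi_rev gam0 gam1 gap T0 g01 (erefl gbar) eps04.
move=> /le_trans; apply; rewrite -mulrA ler_wpM2l// -expRD ler_expR.
have -> : T%:R * gam * (L / s) ^+ 2 / 16 = (T%:R * gam / n%:R) * (L ^+ 2 / 16).
  by rewrite -s2; field; rewrite gt_eqF.
have L2 : 1 <= L ^+ 2 by rewrite exprn_ege1.
have h : 48 <= T%:R * gam / n%:R by rewrite ler_pdivlMr.
have : 48 * (L ^+ 2 / 16) <= T%:R * gam / n%:R * (L ^+ 2 / 16).
  by rewrite ler_wpM2r// divr_ge0 ?sqr_ge0.
by lra.
Qed.

End Main.

(** * Proof of the coverage, length and run-time claims *)

Lemma wide_spread_deviation (R : realType) (n : nat) (a : 'I_n -> R) (mu e : R) :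
  ~~ spread_le (2 * e) a -> exists i, e < `|a i - mu|.
Proof.
move=> /forallPn[i /forallPn[j]]; rewrite -ltNge => lt_ij.
have [le_i|] := leP `|a i - mu| e; last by exists i.
exists j; rewrite distrC; apply: lt_le_trans (ler_norm _).
by have := le_trans (ler_norm _) le_i; lra.
Qed.

Theorem theorem2p2 (R : realType) (n a : nat) (alpha tau : R)
    (hn : (5 <= n)%N) (halpha0 : 0 < alpha) (halpha1 : alpha < 1)
    (htau : 1 <= tau) (hntau : n%:R * tau \is a Num.int) :
  exists A : adaptive_procedure n a tau,
    forall (S : finType) (pi : S -> R) (K : S -> S -> R) (g : S -> R)
      (d : measure_display) (Omega : measurableType d)
      (P : probability Omega R) (X : 'I_(2 * n) -> nat -> Omega -> S),
      is_distribution pi ->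
      is_transition K ->
      reversible pi K ->
      (forall i, 0 <= g i <= 1) ->
      (forall r, markov_chain P pi K (X r)) ->
      independent_processes P X ->
      let y := fun (w : Omega) (r : 'I_(2 * n)) (j : nat) => g (X r j w) in
      let M := fun w : Omega => run_length A (y w) in
      let gbar := \sum_i pi i * g i in
      [/\ (P [set w | gbar \notin output_interval A (y w)] <= alpha%:E)%E,
          forall w : Omega, 1 <= M w / tau < 2 ^+ a ->
            output_length A (y w) <= k_const a alpha * (ln n%:R / n%:R) &
          forall l : seq R, (2 <= #|S|)%N -> eigenvalue_list K l ->
            (P [set w | (96%:E * maxe (relaxation_time l) tau%:E < (M w)%:E)%E]
             <= (3 * n%:R * (n%:R + 1) * expR (- (ln n%:R) ^+ 2))%:E)%E].
Proof.
have n0 : (0 < n)%N by exact: leq_trans hn.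
have nR : 0 < n%:R :> R by rewrite ltr0n.
have tau0 : 0 < tau by exact: lt_le_trans htau.
have [N N_def] : exists N, n%:R * tau = N%:R.
  by apply/natrP; rewrite natrEint hntau mulr_ge0// ltW.
have N0 : (0 < N)%N by rewrite -(ltr0n R) -N_def mulr_gt0.
exists (clipping_procedure a N_def n0 halpha0 halpha1).
move=> S pi K g d Omega P X pi_dist K_trans pi_rev g01 mcX indX y M gbar.
have T0 k : (0 < 2 ^ k * N)%N by rewrite muln_gt0 expn_gt0.
have TR k : (2 ^ k * N)%:R = n%:R * (2 ^+ k * tau) :> R.
  by rewrite natrM natrX -N_def mulrCA.
have ME w : M w = 2 ^+ stop_stage a N (y w) * tau.
  by rewrite /M /run_length /= inordK// ltnS stop_stage_le.
(* The largest horizon used: all events below depend only on the states before it. *)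
pose Tmax := (2 ^ a * N)%N.
have obs_le w w' k : (k <= a)%N ->
    (forall r j, (j < Tmax)%N -> X r j w = X r j w') ->
    forall r j, (j < 2 ^ k * N)%N -> y w r j = y w' r j.
  move=> ka XX r j jlt; rewrite /y XX//; apply: leq_trans jlt _.
  by rewrite leq_mul// leq_pexp2l.
have stage_eq w w' : (forall r j, (j < Tmax)%N -> X r j w = X r j w') ->
    stop_stage a N (y w') = stop_stage a N (y w).
  by move=> XX; apply: stop_stage_adapted; apply: obs_le XX; exact: stop_stage_le.
have gbar01 : 0 <= gbar <= 1.
  rewrite sumr_ge0/=; last first.
    by move=> i _; rewrite mulr_ge0 ?(proj1 pi_dist)//; case/andP: (g01 i).
  rewrite -(proj2 pi_dist); apply: ler_sum => i _.
  by rewrite ler_piMr ?(proj1 pi_dist)//; case/andP: (g01 i).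
split.
- pose F (k : 'I_a) := [set w | stops_at (y w) (2 ^ k * N) &&
    (half_width n a alpha < `|estimate (y w) (2 ^ k * N) - gbar|)].
  have FE (k : 'I_a) : (P (F k) <= (alpha / a.+1%:R)%:E)%E.
    exact: stage_coverage.
  (* A miss can occur only at one of the [a] tested stages, since [0,1] contains [gbar]; each costs
     at most [alpha / (a + 1)]. *)
  apply: (@le_trans _ _ (\sum_(k < a) P (F k))%E).
    apply: union_bound.
    + apply: (@observable_measurable R d Omega P S pi K n X mcX Tmax) => w w' XX /=.
      rewrite /output_interval /= /ci_lower /ci_upper (stage_eq w w' XX).
      by rewrite (eq_estimate (obs_le w w' _ (stop_stage_le _ _ _) XX)).
    + move=> k; apply: (@observable_measurable R d Omega P S pi K n X mcX Tmax) => w w' XX /=.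
      have e := obs_le w w' k (ltnW (ltn_ord k)) XX.
      by rewrite /F /= (eq_estimate e) (eq_stops_at e).
    + move=> w /=; rewrite in_itv/= /ci_lower /ci_upper.
      case: ifPn => [lt_a|_]; last by rewrite gbar01.
      move=> out; exists (Ordinal lt_a); rewrite /F /= stops_at_stop_stage//=.
      rewrite ltNge; apply: contra out; rewrite ler_norml => /andP[h1 h2].
      by apply/andP; split; lra.
  apply: (@le_trans _ _ (\sum_(k < a) (alpha / a.+1%:R)%:E)%E).
    by apply: lee_sum => k _; exact: FE.
  rewrite sumEFin lee_fin sumr_const card_ord -[leLHS]mulr_natl mulrCA ler_piMr ?(ltW halpha0)//.
  by rewrite ler_pdivrMr ?ltr0n// mul1r ler_nat.
- move=> w /andP[_]; rewrite ME mulfK ?gt_eqF// ltr_eXn2l ?ltr1n// => lt_a.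
  rewrite /output_length /= /ci_lower /ci_upper lt_a /half_width /k_const.
  by lra.
move=> l S2 eigK.
set L := ln n%:R; have L1 : 1 <= L by exact: ln_ge1.
set rhs : R := 3 * n%:R * (n%:R + 1) * _.
have rhs0 : 0 <= rhs by rewrite mulr_ge0 ?expR_ge0// !mulr_ge0 ?addr_ge0// ltW.
(* If the eigenvalue 1 is repeated, the threshold is infinite and the event empty. *)
rewrite /relaxation_time; case: ifPn => [_|l1].
  rewrite (_ : [set w | _] = set0) ?measure0 ?lee_fin//.
  apply/seteqP; split=> w //=.
  by rewrite maxye gt0_muley ?lte_fin// ltNge leey.
have l1lt : l`_1 < 1.
  rewrite lt_neqAle l1; apply: (mem_eigenvalue_list_le1 K_trans eigK).
  by rewrite mem_nth// (eigenvalue_list_size eigK).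
rewrite -EFin_max -EFinM; set t2 := (1 - l`_1)^-1; set m := Num.max t2 tau.
have m1 : 1 <= m by rewrite le_max htau orbT.
have m0 : 0 < m by exact: lt_le_trans m1.
(* [1 / m] is a lower bound for the gap since [m >= t2], and it is at most 1 since
   [m >= tau >= 1]. *)
have gam0 : 0 < m^-1 by rewrite invr_gt0.
have gam1 : m^-1 <= 1 by rewrite invf_le1.
have gam_l : l`_1 <= 1 - m^-1.
  rewrite lerBrDr -lerBrDl -[leRHS]invrK lef_pV2 ?posrE ?invr_gt0 ?subr_gt0//.
  by rewrite le_max lexx.
have gam_ge0 : 0 <= 1 - m^-1 by rewrite subr_ge0.
have gap := spectral_gap pi_dist K_trans pi_rev S2 eigK l1 gam_l gam_ge0.
set E := [set w | _].
have [[w0 Ew0]|noE] := pselect (exists w, E w); last first.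
  rewrite (_ : E = set0) ?measure0 ?lee_fin//.
  by apply/seteqP; split=> w // Ew; exfalso; apply: noE; exists w.
(* [k] is the first stage with [2^k tau > 48 m]. It is not 0, as [tau <= m], so doubling the
   previous stage gives [2^k tau <= 96 m]. A run longer than [96 m] thus fails to stop at stage [k],
   which is long enough for the Chernoff bound. The witness [w0] ensures [k <= a]. *)
have ex_k : exists k, 48 * m < 2 ^+ k * tau.
  by exists (stop_stage a N (y w0)); move: Ew0; rewrite /E /= lte_fin ME; lra.
have [k k48 k_min] := ex_minnP ex_k.
have k96 : 2 ^+ k * tau <= 96 * m.
  case: k k48 k_min => [|k] k48 k_min.
    have : tau <= m by rewrite le_max lexx orbT.
    by move: k48; rewrite expr0 mul1r; lra.
  rewrite exprS -mulrA; have : ~~ (48 * m < 2 ^+ k * tau).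
    by apply/negP => /k_min; rewrite ltnn.
  by rewrite -leNgt; lra.
have E_lt w : E w -> (k < stop_stage a N (y w))%N.
  rewrite /E /= lte_fin ME => lt96; have := le_lt_trans k96 lt96.
  by rewrite ltr_pM2r// ltr_eXn2l ?ltr1n.
pose F (i : 'I_n) := [set w |
  L / Num.sqrt n%:R < `|block_mean (y w) (2 ^ k * N) (of_half (inl i)) - gbar|].
have FE i : (P (F i) <= (2 * expR (- L ^+ 2))%:E)%E.
  apply: block_deviation gap _ _ => //.
  rewrite TR; rewrite [leLHS]mulrC -mulrA ler_pM2l// ler_pdivlMr//; exact: ltW.
have ka : (k <= a)%N by exact: ltnW (leq_trans (E_lt _ Ew0) (stop_stage_le _ _ _)).
apply: (@le_trans _ _ (\sum_(i < n) P (F i))%E).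
  apply: union_bound.
  - apply: (@observable_measurable R d Omega P S pi K n X mcX Tmax) => w w' XX.
    by rewrite /E /= !ME (stage_eq w w' XX).
  - move=> i; apply: (@observable_measurable R d Omega P S pi K n X mcX Tmax) => w w' XX.
    by rewrite /F /= (eq_block_mean (obs_le w w' k ka XX)).
  - move=> w /E_lt /not_stops_before; exact: wide_spread_deviation.
apply: (@le_trans _ _ (\sum_(i < n) (2 * expR (- L ^+ 2))%:E)%E).
  by apply: lee_sum => i _; exact: FE.
(* The [n] pilot chains give the factor [2 n], below the required [3 n (n + 1)]. *)
rewrite sumEFin lee_fin sumr_const card_ord -mulr_natl /rhs -/L.
rewrite [leRHS]mulrAC -[leRHS]mulrA; have e0 := expR_ge0 (- L ^+ 2).
set e := expR _ in e0 *.
have : 0 <= n%:R * e by rewrite mulr_ge0// ltW.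
have : 0 <= n%:R * (n%:R * e) by rewrite !mulr_ge0// ltW.
by lra.
Qed.
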